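(* Let $H\in(0,1/2)$, let $W=\{W_t,\ t\in[0,1]\}$ be a Wiener process, and let $B^H_t=\int_0^t z(t,s)\,dW_s$, $t\in[0,1]$, be the fractional Brownian motion with Hurst index $H$ given by the Molchan representation with respect to $W$ (with kernel $z$ and constant $c_H$ as in the context). For $\gamma>0$ put $$t_1=t_1(\gamma,H)=\left(c_H B\left(\gamma-H+\tfrac32,H+\tfrac12\right)(\gamma+1)-\sqrt{c_H^2\left(B\left(\gamma-H+\tfrac32,H+\tfrac12\right)(\gamma+1)\right)^2-2H}\right)^{\frac{1}{\gamma-H+\frac12}},$$ where $B(\cdot,\cdot)$ is the beta function. Then: (i) For all $\gamma>0$ the maximum $$\max_{t\in[0,1]}\mathrm{E}\left(B^H_t-\int_0^t s^\gamma\,dW_s\right)^2$$ is reached at one of the two points $t=1$ or $t=t_1$. (ii) For any $H\in(0,1/2)$ there exists $\gamma_0=\gamma_0(H)>0$ such that for all $\gamma>\gamma_0$ the maximum is reached at the point $t_1$ and $$\max_{t\in[0,1]}\mathrm{E}\left(B^H_t-\int_0^t s^\gamma\,dW_s\right)^2=t_1^{2H}-2t_1^{\gamma+\frac12+H}c_H B\left(\gamma-H+\tfrac32,H+\tfrac12\right)\frac{\gamma+1}{\gamma+\frac12+H}+\frac{1}{2\gamma+1}t_1^{2\gamma+1}.$$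
   Context: A fractional Brownian motion (fBm) with Hurst index $H\in(0,1)$ is a centered Gaussian process $\{B^H_t,\ t\ge0\}$ with covariance $\mathrm{E}B^H_tB^H_s=\frac12(t^{2H}+s^{2H}-|t-s|^{2H})$. The fBm is represented on the interval $[0,1]$ via a Wiener process $W$ as $B^H_t=\int_0^t z(t,s)\,dW_s$ (Wiener integral), where, for $0<s<t$, the Molchan kernel is $$z(t,s)=c_H\left(t^{H-1/2}s^{1/2-H}(t-s)^{H-1/2}-(H-1/2)s^{1/2-H}\int_s^t u^{H-3/2}(u-s)^{H-1/2}\,du\right),$$ with $$c_H=\left(\frac{2H\,\Gamma(\frac32-H)}{\Gamma(H+\frac12)\,\Gamma(2-2H)}\right)^{1/2},$$ and $\Gamma$ is the Gamma function. The integral $\int_0^t s^\gamma\,dW_s$ is taken with respect to the same Wiener process $W$. $B(x,y)$, $x,y>0$, is the (Euler) beta function. *)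

(* Defs.v *)
From HB Require Import structures.
From mathcomp Require Import all_boot all_order all_algebra.
From mathcomp Require Import all_classical all_reals all_analysis.

Set Implicit Arguments.
Unset Strict Implicit.
Unset Printing Implicit Defensive.

Import Order.TTheory GRing.Theory Num.Theory.
Import numFieldNormedType.Exports.

Local Open Scope classical_set_scope.
Local Open Scope ring_scope.

Definition Gamma {R : realType} (a : R) : R :=
  \int[lebesgue_measure]_(x in `]0, +oo[) (x `^ (a - 1) * expR (- x)).

(* The library's [beta_fun] only takes natural-number arguments. *)
Definition Beta {R : realType} (a b : R) : R :=
  \int[lebesgue_measure]_(x in `]0, 1[) (x `^ (a - 1) * (1 - x) `^ (b - 1)).

Section molchan_kernel.
Context {R : realType} (H : R).

Definition molchan_const : R :=
  Num.sqrt (2 * H * Gamma (3 / 2 - H) / (Gamma (H + 1 / 2) * Gamma (2 - 2 * H))).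

(* Only meaningful for 0 < s < t. *)
Definition molchan_kernel (t s : R) : R :=
  molchan_const *
    (t `^ (H - 1 / 2) * s `^ (1 / 2 - H) * (t - s) `^ (H - 1 / 2)
     - (H - 1 / 2) * s `^ (1 / 2 - H) *
       \int[lebesgue_measure]_(u in `]s, t[)
         (u `^ (H - 3 / 2) * (u - s) `^ (H - 1 / 2))).

End molchan_kernel.

Section gaussian.
Context {R : realType} {d : measure_display} {T : measurableType d}
  (P : probability T R).

(* [normal_prob m 0] is not the Dirac mass at m in the library, so the
   degenerate case is treated apart. *)
Definition has_gaussian_law (m sigma : R) (X : T -> R) : Prop :=
  forall A : set R, measurable A ->
    P (X @^-1` A) = if sigma == 0 then \d_m A else normal_prob m sigma A.

Definition gaussian_process (D : set R) (X : R -> {RV P >-> R}) : Prop :=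
  forall (n : nat) (c t : 'I_n -> R), (forall i, D (t i)) ->
    exists m sigma : R,
      0 <= sigma /\ has_gaussian_law m sigma (fun w => \sum_i c i * X (t i) w).

(* Taking some of the sets A i equal to setT gives the product rule for every
   subfamily. *)
Definition mutually_independent (n : nat) (X : 'I_n -> T -> R) : Prop :=
  forall A : 'I_n -> set R, (forall i, measurable (A i)) ->
    fine (P [set w | forall i, A i (X i w)]) =
    \prod_(i < n) fine (P (X i @^-1` A i)).

Definition wiener_process (W : R -> {RV P >-> R}) : Prop :=
  [/\ {ae P, forall w, W 0 w = 0},
      forall (n : nat) (t : nat -> R),
        {homo t : i j / (i <= j)%N >-> i <= j} ->
        (forall i, t i \in `[0, 1]) ->
        mutually_independent (fun (i : 'I_n) w => W (t i.+1) w - W (t i) w),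
      forall s t : R, 0 <= s -> s <= t -> t <= 1 ->
        has_gaussian_law 0 (Num.sqrt (t - s)) (fun w => W t w - W s w) &
      {ae P, forall w, {within `[0, 1], continuous (fun t => W t w)}}].

(* D is the time set, contained in the nonnegative half-line. *)
Definition fractional_brownian_motion (H : R) (D : set R)
    (B : R -> {RV P >-> R}) : Prop :=
  [/\ gaussian_process D B,
      forall t, D t -> ('E_P[B t] = 0)%E &
      forall t s, D t -> D s ->
        'E_P[fun w => (B t w * B s w)%R]%E =
        (1 / 2 * (t `^ (2 * H) + s `^ (2 * H) - `|t - s| `^ (2 * H)))%:E].

End gaussian.

Section wiener_integral.
Context {R : realType} {d : measure_display} {T : measurableType d}
  (P : probability T R).

(* An entry (a, (u, v)) stands for the function equal to a on ]u, v] and to 0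
   elsewhere; the intervals of a list may overlap. *)
Definition step_data := seq (R * (R * R)).

Definition step_in01 (c : step_data) : Prop :=
  forall p, p \in c -> [/\ 0 <= p.2.1, p.2.1 <= p.2.2 & p.2.2 <= 1].

Definition step_fun (c : step_data) (s : R) : R :=
  \sum_(p <- c) p.1 * \1_(`]p.2.1, p.2.2]) s.

Definition step_integral (W : R -> {RV P >-> R}) (c : step_data) (w : T) : R :=
  \sum_(p <- c) p.1 * (W p.2.2 w - W p.2.1 w).

(* X is a version of the Wiener integral of f over [0, 1]: the L^2(P)-limit of
   the integrals of step functions converging to f in L^2([0, 1]). *)
Definition is_wiener_integral01 (W : R -> {RV P >-> R}) (f : R -> R)
    (X : {RV P >-> R}) : Prop :=
  [/\ measurable_fun (`[0, 1] : set R) f,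
      lebesgue_measure.-integrable (`[0, 1] : set R) (fun s => (f s ^+ 2)%:E) &
      exists c : nat -> step_data,
        [/\ forall n, step_in01 (c n),
            (fun n => \int[lebesgue_measure]_(s in `[0%R, 1%R])
                        ((f s - step_fun (c n) s) ^+ 2)%R%:E)%E @ \oo --> 0%E &
            (fun n => 'E_P[fun w => ((X w - step_integral W (c n) w) ^+ 2)%R])%E
              @ \oo --> 0%E]].

(* X is a version of the integral of f from 0 to t, for t in [0, 1]. *)
Definition is_wiener_integral (W : R -> {RV P >-> R}) (t : R) (f : R -> R)
    (X : {RV P >-> R}) : Prop :=
  is_wiener_integral01 W (f \_ `]0, t[) X.

End wiener_integral.

(* W is a Wiener process on [0, 1], and B is the fractional Brownian motion
   obtained from it through the Molchan representation. *)
Definition molchan_fbm {R : realType} {d : measure_display}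
    {T : measurableType d} (P : probability T R) (H : R)
    (W B : R -> {RV P >-> R}) : Prop :=
  [/\ wiener_process W,
      fractional_brownian_motion H `[0, 1] B &
      forall t, t \in `[0, 1] ->
        is_wiener_integral W t (molchan_kernel H t) (B t)].

(* M t is a version of the integral of s^gamma dW_s from 0 to t. *)
Definition power_integral {R : realType} {d : measure_display}
    {T : measurableType d} (P : probability T R) (gamma : R)
    (W M : R -> {RV P >-> R}) : Prop :=
  forall t, t \in `[0, 1] ->
    is_wiener_integral W t (fun s => s `^ gamma) (M t).

Definition mean_square_distance {R : realType} {d : measure_display}
    {T : measurableType d} (P : probability T R)
    (B M : R -> {RV P >-> R}) (t : R) : \bar R :=
  'E_P[fun w => ((B t w - M t w) ^+ 2)%R]%E.

Definition max_reached_at {R : realType} (D : set R) (f : R -> \bar R) (p : R) :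
    Prop :=
  D p /\ forall t, D t -> (f t <= f p)%E.

Definition t1 {R : realType} (gamma H : R) : R :=
  let b := Beta (gamma - H + 3 / 2) (H + 1 / 2) in
  let c := molchan_const H in
  (c * b * (gamma + 1) - Num.sqrt (c ^+ 2 * (b * (gamma + 1)) ^+ 2 - 2 * H))
    `^ (1 / (gamma - H + 1 / 2)).

(* Main.v *)
Require Import Defs.
From HB Require Import structures.
From mathcomp Require Import all_boot all_order all_algebra.
From mathcomp Require Import all_classical all_reals all_analysis.
From mathcomp Require Import measurable_realfun.
From mathcomp Require Import ring lra.

Set Implicit Arguments.
Unset Strict Implicit.
Unset Printing Implicit Defensive.

Import Order.TTheory GRing.Theory Num.Theory.
Import numFieldNormedType.Exports.

Local Open Scope classical_set_scope.
Local Open Scope ring_scope.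

(** Both [B t] and [M t] are Wiener integrals over [`]0, t[], so by the Wiener
    isometry ([wiener_isometryB]) the mean square distance is the integral of
    the square of [z (t, s) - s `^ gamma]. Expanding the square gives three
    terms. The first one is the variance [t `^ (2 * H)] of [B t], the third one
    is the integral of [s `^ (2 * gamma)], and the cross term is computed by
    exchanging the order of integration in the inner integral of the Molchan
    kernel ([integral_molchan_power]). With [c] the constant of the kernel, [b]
    the value of the beta function and [A = c * b * (gamma + 1)], the distance
    is the function [profile A H gamma] of [t] ([mean_square_distanceE]).

    The derivative of this function is
    [t `^ (2 * H - 1) * (x ^+ 2 - 2 * A * x + 2 * H)] with
    [x = t `^ (gamma - H + 1 / 2)]. Hence it increases until [x] reaches the
    smaller root, that is, until [t = t1 gamma H], decreases until [x] reaches
    the larger root, and increases again. On [[0, 1]] its maximum is therefore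
    attained at [t1 gamma H] or at [1] ([profile_dichotomy]).

    For the second part, [A] tends to infinity with [gamma]: the constant [c]
    is positive since [B 1] has variance [1] ([molchan_const_gt0]), and near
    [1] the beta integrand is large enough ([critical_coefficient_large]). When
    [A] is large, the distance at time [1] falls short of [1] by an amount of
    order [A / gamma], and at [t1 gamma H] by an amount of order [ln A / gamma]
    only, so that the latter point wins ([critical_time_beats1]).

    The isometry itself is proved on step functions and extended by
    approximation. For step functions it rests on an algebraic identity: a
    linear combination [\sum_i a i * x i] with [\sum_i a i = 0] satisfies
    [(\sum_i a i * x i) ^+ 2 =
       - (1 / 2) * \sum_i \sum_j a i * a j * (x i - x j) ^+ 2],
    so that second moments of step integrals follow from those of the single
    increments, namely the variances of normal laws
    ([normal_prob_second_moment]). *)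

(** * Tonelli's theorem on a triangle *)

Section tonelli_triangle.
Context {R : realType}.
Local Notation mu := (@lebesgue_measure R).
Local Open Scope ereal_scope.

Variables (D : set R) (f : R -> R -> \bar R).
Hypotheses (mD : measurable D)
  (mf : measurable_fun [set: R * R] (fun z : R * R => f z.1 z.2))
  (f0 : forall x y, 0 <= f x y).

Let E := (D `*` D) `&` [set z : R * R | (z.1 < z.2)%R].
Let g := (fun z : R * R => f z.1 z.2) \_ E.

Let mg : measurable_fun [set: R * R] g.
Proof.
have mE : measurable E.
  apply: measurableI; first exact: measurableX.
  have := measurable_fun_ltr measurable_fst measurable_snd
    : measurable_fun [set: R * R] _.
  move=> /(_ measurableT [set true]); rewrite setTI; apply.
  by [].
exact/(measurable_restrictT _ mE)/measurable_funTS.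
Qed.

Let g0 z : 0 <= g z.
Proof. by rewrite /g patchE; case: ifPn. Qed.

Let gE x y : g (x, y) = if [&& x \in D, y \in D & (x < y)%R] then f x y else 0.
Proof.
rewrite /g patchE /=; congr (if _ then _ else _); apply/idP/and3P.
  by move=> /set_mem[[/= Dx Dy] xy]; split; rewrite ?inE.
by move=> [/set_mem Dx /set_mem Dy xy]; rewrite inE.
Qed.

Let integral_g x : x \in D ->
  \int[mu]_y g (x, y) = \int[mu]_(y in D `&` `]x, +oo[) f x y.
Proof.
move=> xD; rewrite [RHS]integral_mkcond; apply: eq_integral => y _.
by rewrite gE xD patchE in_setI /= mem_setE in_itv /= andbT.
Qed.

Lemma measurable_integral_triangle :
  measurable_fun (D : set (measurableTypeR R))
    (fun x => \int[mu]_(y in D `&` `]x, +oo[) f x y).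
Proof.
apply: eq_measurable_fun (measurable_funTS
  (measurable_fun_fubini_tonelli_F (m2 := mu) g mg g0)) => x xD.
exact: integral_g.
Qed.

(** The triangle [x < y] in [D `*` D] is sliced horizontally or vertically:
    both iterated integrals are those of [f] restricted to the triangle. *)
Lemma tonelli_triangle :
  \int[mu]_(x in D) \int[mu]_(y in D `&` `]x, +oo[) f x y =
  \int[mu]_(y in D) \int[mu]_(x in D `&` `]-oo, y[) f x y.
Proof.
have := fubini_tonelli (m1 := mu) (m2 := mu) g mg g0.
rewrite [in X in _ -> X = _]integral_mkcond [in X in _ -> _ = X]integral_mkcond.
congr (_ = _); apply: eq_integral => x _.
- rewrite patchE; case: ifPn => xD; first exact: integral_g.
  by apply: integral0_eq => y _; rewrite gE (negbTE xD).
- rewrite patchE; case: ifPn => xD; last first.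
    by apply: integral0_eq => y _; rewrite gE (negbTE xD) andbF.
  rewrite [RHS]integral_mkcond; apply: eq_integral => y _.
  by rewrite gE xD patchE in_setI /= mem_setE in_itv.
Qed.

End tonelli_triangle.

(** * The variance of the centered normal law *)

Section normal_second_moment.
Context {R : realType}.
Local Notation mu := (@lebesgue_measure R).

(** The normal law is absolutely continuous, so the change of variables holds
    with its Radon-Nikodym derivative; that derivative is the density almost
    everywhere because both have the same integral over every Borel set. *)
Lemma integral_normal_prob (m s : R) (f : R -> \bar R) :
  measurable_fun [set: R] f -> (forall x, 0 <= f x)%E ->
  (\int[normal_prob m s]_x f x = \int[mu]_x (f x * (normal_pdf m s x)%:E))%E.
Proof.
move=> mf f0.
pose nu : {finite_measure set (measurableTypeR R) -> \bar R} := normal_prob m s.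
have numu : nu `<< mu by exact: normal_prob_dominates.
have := Radon_Nikodym_SigmaFinite.change_of_variables numu f0 measurableT mf.
move=> <-.
have RNi := Radon_Nikodym_SigmaFinite.f_integrable numu.
apply: ge0_ae_eq_integral => //.
- exact: emeasurable_funM (measurable_int _ RNi).
- apply: emeasurable_funM => //; apply/measurable_EFinP.
  exact: measurable_normal_pdf.
- move=> x _; apply: mule_ge0 => //.
  exact: Radon_Nikodym_SigmaFinite.f_ge0.
- by move=> x _; apply: mule_ge0; rewrite ?lee_fin ?normal_pdf_ge0.
apply: ae_eqe_mul2l; apply: integral_ae_eq => //.
  by apply/measurable_EFinP; exact: measurable_normal_pdf.
by move=> E _ mE; rewrite -Radon_Nikodym_SigmaFinite.f_integral.
Qed.

Lemma is_derive_normal_pdf (s x : R) : s != 0 ->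
  is_derive x 1 (normal_pdf 0 s) (- (x / s ^+ 2 * normal_pdf 0 s x)).
Proof.
move=> s0; rewrite normal_pdfE//.
rewrite (_ : (fun _ => _) =
  (fun y => normal_peak s * expR (- (s ^+ 2 *+ 2)^-1 * y ^+ 2))); last first.
  by apply/funext => y; rewrite /normal_fun subr0; congr (_ * expR _); ring.
apply: is_derive_eq.
rewrite /normal_fun subr0 /GRing.scale /= !mulr1 -mulr_natr.
set e := expR _; set e' := expR _.
have -> : e' = e by congr expR; rewrite mulrC mulrN mulNr.
by field.
Qed.

Lemma cvg_normal_pdf (s : R) : s != 0 ->
  normal_pdf 0 s x @[x --> +oo] --> (0 : R).
Proof.
move=> s0; rewrite normal_pdfE//.
rewrite -[X in _ --> X](mulr0 (normal_peak s)).
apply: cvgM; first exact: cvg_cst.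
have s2 : 0 < (s ^+ 2 *+ 2)^-1 by rewrite invr_gt0 pmulrn_lgt0 ?exprn_even_gt0.
have -> : normal_fun 0 s =
    (fun x => expR (- x)) \o (fun x => x * (s ^+ 2 *+ 2)^-1) \o (fun x => x ^+ 2).
  by apply/funext => y /=; rewrite /normal_fun subr0 mulNr.
apply: cvg_comp; first exact: cvgr_expr2.
apply: cvg_comp; last exact: cvgr_expR.
by apply: gt0_cvgMly => //; exact: cvg_id.
Qed.

Lemma integral_normal_pdf_tail (s x : R) : s != 0 -> 0 <= x ->
  (\int[mu]_(y in `]x, +oo[) (y / s ^+ 2 * normal_pdf 0 s y)%:E =
   (normal_pdf 0 s x)%:E)%E.
Proof.
move=> s0 x0.
have cpdf : continuous (normal_pdf 0 s) by exact: continuous_normal_pdf.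
have cf : continuous (fun y : R => y / s ^+ 2 * normal_pdf 0 s y).
  move=> y; apply: cvgM; last exact: cpdf.
  by apply: cvgM; [exact: cvg_id|exact: cvg_cst].
rewrite integral_itv_obnd_cbnd; last first.
  apply/measurable_EFinP/measurable_funTS; exact: continuous_measurable_fun.
have dF y := is_derive_normal_pdf y s0.
rewrite (@ge0_continuous_FTC2y _ _ (fun y => - normal_pdf 0 s y) _ 0).
- by rewrite -EFinB sub0r opprK.
- move=> y xy; rewrite mulr_ge0 ?normal_pdf_ge0// divr_ge0 ?sqr_ge0//.
  exact: le_trans xy.
- exact: continuous_subspaceT.
- by rewrite -[X in _ --> X]oppr0; apply: cvgN; exact: cvg_normal_pdf.
- by move=> y _; apply: derivableN; exact: ex_derive.
- by apply: cvg_at_right_filter; apply: cvgN; exact: cpdf.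
- move=> y _; rewrite derive1E deriveN//.
  by have [_ ->] := dF y; rewrite opprK.
Qed.

(** Write [p] for the density. Since [p' y = - y / s ^+ 2 * p y], the value
    [p x] is the integral of [y / s ^+ 2 * p y] over [y > x]. Exchanging the
    order of integration turns the integral of [p] over the positive half-line
    into that of [y ^+ 2 / s ^+ 2 * p y], the inner integral of the constant
    [1] over [0 < x < y] being [y]. *)
Lemma normal_prob_second_moment (s : R) : s != 0 ->
  (\int[normal_prob 0 s]_x (x ^+ 2)%:E = (s ^+ 2)%:E)%E.
Proof.
move=> s0.
rewrite integral_normal_prob; last 2 first.
- by apply/measurable_EFinP; exact: measurable_funX.
- by move=> x; rewrite lee_fin sqr_ge0.
have mpdf := measurable_normal_pdf 0 s : measurable_fun setT _.
have cpdf : continuous (normal_pdf 0 s) by exact: continuous_normal_pdf.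
have evenpdf : normal_pdf 0 s =1 normal_pdf 0 s \o -%R.
  by move=> x; rewrite /= normal_pdfE// /normal_fun !subr0 sqrrN.
have set0E (g : R -> R) : measurable_fun setT g ->
    (\int[mu]_(x in [set x | (0 <= x)%R]) (g x)%:E = \int[mu]_(x in `]0%R, +oo[) (g x)%:E)%E.
  move=> mg; rewrite integral_itv_obnd_cbnd ?set_itvcy//.
  exact/measurable_EFinP/measurable_funTS.
have half : (\int[mu]_(x in `]0%R, +oo[) (x ^+ 2 / s ^+ 2 * normal_pdf 0 s x)%:E =
    \int[mu]_(x in `]0%R, +oo[) (normal_pdf 0 s x)%:E)%E.
  (* The absolute value makes the integrand nonnegative on the whole plane. *)
  pose f (x y : R) := (`|y| / s ^+ 2 * normal_pdf 0 s y)%:E.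
  have mf : measurable_fun [set: R * R] (fun z => f z.1 z.2).
    apply/measurable_EFinP; apply: measurable_funM.
      apply: measurable_funM => //.
      by apply: measurableT_comp => //; exact: measurable_snd.
    by apply: measurableT_comp => //; exact: measurable_snd.
  have f0 x y : (0 <= f x y)%E.
    by rewrite lee_fin mulr_ge0 ?normal_pdf_ge0 ?divr_ge0 ?sqr_ge0.
  have := tonelli_triangle (measurable_itv `]0, +oo[) mf f0; rewrite /f.
  move=> tri; symmetry.
  transitivity (\int[mu]_(x in `]0%R, +oo[)
     \int[mu]_(y in `]0%R, +oo[ `&` `]x, +oo[) (`|y| / s ^+ 2 * normal_pdf 0 s y)%:E)%E.
    apply: eq_integral => x; rewrite inE /= in_itv /= andbT => x0.
    have -> : `]0, +oo[ `&` `]x, +oo[ = `]x, +oo[%classic :> set R.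
      by apply/setIidr => y /=; rewrite !in_itv /= !andbT; exact: lt_trans.
    rewrite -(integral_normal_pdf_tail s0 (ltW x0)).
    apply: eq_integral => y; rewrite inE /= in_itv /= andbT => xy.
    by have y0 : (0 : R) < y := lt_trans x0 xy; rewrite (gtr0_norm y0).
  rewrite tri; apply: eq_integral => y; rewrite inE /= in_itv /= andbT => y0.
  rewrite integral_cst; last exact: measurableI.
  have -> : `]0, +oo[ `&` `]-oo, y[ = `]0, y[%classic :> set R.
    by apply/seteqP; split => z /=; rewrite !in_itv /= ?andbT => /andP.
  rewrite /= lebesgue_measure_itv /= lte_fin y0 sube0 -EFinM (gtr0_norm y0).
  by congr EFin; field.
have sq (x : R) : ((x ^+ 2)%:E * (normal_pdf 0 s x)%:E =
    (s ^+ 2)%:E * (x ^+ 2 / s ^+ 2 * normal_pdf 0 s x)%:E)%E.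
  by rewrite -!EFinM; congr EFin; field.
under eq_integral do rewrite sq.
have mh : measurable_fun [set: R] (fun x : R => x ^+ 2 / s ^+ 2 * normal_pdf 0 s x).
  by apply: measurable_funM => //; apply: measurable_funM => //; exact: measurable_funX.
have h0 x : 0 <= x ^+ 2 / s ^+ 2 * normal_pdf 0 s x.
  by rewrite mulr_ge0 ?normal_pdf_ge0 ?divr_ge0 ?sqr_ge0.
rewrite ge0_integralZl_EFin ?sqr_ge0//; last 2 first.
- by move=> x _; rewrite lee_fin.
- exact/measurable_EFinP.
rewrite ge0_symfun_integralT//; last 2 first.
- move=> x; apply: cvgM; last exact: cpdf.
  by apply: cvgM; [exact: sqr_continuous|exact: cvg_cst].
- by move=> x /=; rewrite sqrrN [normal_pdf 0 s x]evenpdf.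
rewrite set0E// half -set0E// -ge0_symfun_integralT//.
- by rewrite integral_normal_pdf mule1.
- by move=> x; exact: normal_pdf_ge0.
Qed.

End normal_second_moment.

(** * The isometry on step functions *)

Section zero_sum_square.
Context {R : realFieldType} (I : finType).

(** Expanding the double sum, the square terms carry the factor [\sum_i a i],
    which vanishes; only the cross terms [- 2 * (a i * x i) * (a j * x j)]
    remain. *)
Lemma sqr_zero_sum_combination (a x : I -> R) : \sum_i a i = 0 ->
  (\sum_i a i * x i) ^+ 2 =
  - (1 / 2) * \sum_i \sum_j a i * a j * (x i - x j) ^+ 2.
Proof.
move=> a0; set s := \sum_i a i * x i; set q := \sum_i a i * x i ^+ 2.
have -> : \sum_i \sum_j a i * a j * (x i - x j) ^+ 2 =
    \sum_i (a i * x i ^+ 2 * \sum_j a j + a i * q - 2 * (a i * x i) * s).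
  apply: eq_bigr => i _; rewrite /q /s !mulr_sumr -sumrN -!big_split /=.
  by apply: eq_bigr => j _; ring.
rewrite !big_split /= sumrN -!mulr_suml -mulr_sumr -/s a0.
by field.
Qed.

End zero_sum_square.

Section increment_isometry.
Context {R : realType} {d : measure_display} {T : measurableType d}
  (mu : {measure set T -> \bar R}) (D : set T).

(** A linear combination of increments is a combination of the values of the
    process whose coefficients sum to zero. Its second moment is therefore
    determined by those of the differences of these values. *)
Lemma integral_sqr_zero_sum_combination (I : finType) (a : I -> R)
    (X : I -> T -> R) (K : I -> I -> R) :
  measurable D ->
  (forall i, measurable_fun D (X i)) ->
  (forall i j, \int[mu]_(w in D) ((X i w - X j w) ^+ 2)%:E = (K i j)%:E)%E ->
  \sum_i a i = 0 ->
  (\int[mu]_(w in D) ((\sum_i a i * X i w) ^+ 2)%:E =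
   (- (1 / 2) * \sum_i \sum_j a i * a j * K i j)%:E)%E.
Proof.
move=> mD mX XK a0.
have iX i j : mu.-integrable D (fun w => ((X i w - X j w) ^+ 2)%:E).
  apply/integrableP; split.
    by apply/measurable_EFinP/measurable_funX/measurable_funB.
  under eq_integral do rewrite /= ger0_norm ?sqr_ge0//.
  by rewrite XK ltry.
pose F (ij : I * I) w := ((a ij.1 * a ij.2)%:E * ((X ij.1 w - X ij.2 w) ^+ 2)%:E)%E.
have iF ij : mu.-integrable D (F ij) by exact: integrableZl.
transitivity (\int[mu]_(w in D) ((- (1 / 2))%:E * \sum_ij F ij w))%E.
  apply: eq_integral => w _; rewrite sqr_zero_sum_combination// EFinM.
  by congr (_ * _)%E; rewrite pair_big /= -sumEFin.
rewrite integralZl//; last exact: integrable_sum.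
rewrite integral_sum// EFinM; congr (_ * _)%E.
rewrite pair_big /= -sumEFin; apply: eq_bigr => ij _.
by rewrite /F integralZl// XK.
Qed.

End increment_isometry.

Section gaussian_variance.
Context {R : realType} {d : measure_display} {T : measurableType d}
  (P : probability T R).

Lemma gaussian_second_moment (s : R) (X : {RV P >-> R}) :
  has_gaussian_law P 0 s X -> (\int[P]_w (X w ^+ 2)%:E = (s ^+ 2)%:E)%E.
Proof.
move=> lawX.
(* [normal_prob] is a measure on [measurableTypeR R], so [X] is given values in
   that type before its law is pushed forward. *)
have mX : measurable_fun [set: T] (X : T -> measurableTypeR R).
  exact: (@measurable_funPT _ _ _ _ X).
have mf : measurable_fun [set: measurableTypeR R] (fun x : R => (x ^+ 2)%:E).
  by apply/measurable_EFinP; exact: measurable_funX.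
have := @ge0_integral_pushforward _ _ T (measurableTypeR R) R X mX P setT
  (fun x => (x ^+ 2)%:E) measurableT mf.
move=> <-; last by move=> y _; rewrite lee_fin sqr_ge0.
have [s0|s0] := eqVneq s 0.
  rewrite (eq_measure_integral (\d_(0 : measurableTypeR R))); last first.
    by move=> A mA _; have := lawX A mA; rewrite s0 eqxx.
  by rewrite integral_dirac// s0 diracT mul1e expr0n.
rewrite (eq_measure_integral (normal_prob 0 s)); last first.
  by move=> A mA _; have := lawX A mA; rewrite (negbTE s0).
exact: normal_prob_second_moment.
Qed.

Lemma wiener_increment_second_moment (W : R -> {RV P >-> R}) (s t : R) :
  wiener_process W -> s \in `[0, 1] -> t \in `[0, 1] ->
  (\int[P]_w ((W s w - W t w) ^+ 2)%:E = `|s - t|%:E)%E.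
Proof.
move=> [_ _ lawW _].
wlog st : s t / s <= t => [hwlog s01 t01|].
  have [st|/ltW ts] := leP s t; first exact: hwlog.
  rewrite distrC -hwlog//.
  by apply: eq_integral => w _; congr EFin; ring.
rewrite !in_itv /= => /andP[s0 s1] /andP[t0 t1].
pose X : {RV P >-> R} := (W t \- W s)%R.
have := @gaussian_second_moment (Num.sqrt (t - s)) X (lawW s t s0 st t1).
rewrite sqr_sqrtr ?subr_ge0// distrC ger0_norm ?subr_ge0// => <-.
by apply: eq_integral => w _; congr EFin; rewrite /X /=; ring.
Qed.

End gaussian_variance.

Section step_isometry.
Context {R : realType}.
Local Notation mu := (@lebesgue_measure R).

(** The map sending a time [s] to the indicator of [`]0, s]] behaves in
    $L^2([0, 1])$ exactly as the Wiener process does in $L^2(P)$. *)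
Lemma indic_increment_second_moment (s t : R) :
  s \in `[0, 1] -> t \in `[0, 1] ->
  (\int[mu]_(x in `[0%R, 1%R])
     ((\1_(`]0%R, s]) x - \1_(`]0%R, t]) x) ^+ 2)%:E = `|s - t|%:E)%E.
Proof.
wlog st : s t / s <= t => [hwlog s01 t01|].
  have [st|/ltW ts] := leP s t; first exact: hwlog.
  rewrite distrC -hwlog//.
  by apply: eq_integral => w _; congr EFin; ring.
rewrite !in_itv /= => /andP[s0 s1] /andP[t0 t1].
transitivity (\int[mu]_(x in `[0%R, 1%R]) (\1_(`]s, t]) x)%:E)%E.
  apply: eq_integral => x _; congr EFin; rewrite !indicE !mem_setE !in_itv /=.
  have [x0|x0] := ltP 0 x; have [xs|xs] := leP x s; have [xt|xt] := leP x t => /=;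
    rewrite ?subrr ?subr0 ?expr0n ?sub0r ?sqrrN ?expr1n//; exfalso; lra.
rewrite integral_indic//.
have -> : `]s, t] `&` `[0, 1] = `]s, t]%classic :> set R.
  apply/setIidl => x /=; rewrite !in_itv /= => /andP[sx xt]; apply/andP.
  by split; lra.
rewrite /= lebesgue_measure_itv /= lte_fin distrC ger0_norm ?subr_ge0//.
case: ltP => // ts; have -> : t = s by apply/le_anti/andP.
by rewrite subrr.
Qed.

Lemma step_funE (c : step_data) (x : R) : step_in01 c ->
  step_fun c x = \sum_(p <- c) p.1 * (\1_(`]0%R, p.2.2]) x - \1_(`]0%R, p.2.1]) x).
Proof.
move=> c01; rewrite /step_fun big_seq [RHS]big_seq; apply: eq_bigr => p pc.
have [u0 uv v1] := c01 p pc; congr (_ * _); rewrite !indicE !mem_setE !in_itv /=.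
have [x0|x0] := ltP 0 x; have [xu|xu] := leP x p.2.1; have [xv|xv] := leP x p.2.2 => /=;
  rewrite ?subrr ?subr0//; exfalso; lra.
Qed.

(** The index [(i, true)] (resp. [(i, false)]) stands for the right (resp. left)
    end of the [i]-th interval, so that the coefficients sum to zero. *)
Lemma sum_increments (c : step_data) (X : R -> R) :
  let a (k : 'I_(size c) * bool) :=
    (if k.2 then 1 else -1) * (nth (0, (0, 0)) c k.1).1 in
  let t (k : 'I_(size c) * bool) :=
    let uv := (nth (0, (0, 0)) c k.1).2 in if k.2 then uv.2 else uv.1 in
  \sum_(p <- c) p.1 * (X p.2.2 - X p.2.1) = \sum_k a k * X (t k).
Proof.
move=> a t; rewrite (big_nth (0, (0, 0))) big_mkord.
transitivity (\sum_i \sum_b a (i, b) * X (t (i, b))).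
  by apply: eq_bigr => i _; rewrite big_bool /a /t /=; ring.
by rewrite pair_big /=; apply: eq_bigr => -[].
Qed.

(** Both sides are second moments of the same zero-sum combination, of values
    of [W] on the left and of indicators on the right, and the increments of
    these two families have the same second moments. *)
Lemma step_isometry {d : measure_display} {T : measurableType d}
    (P : probability T R) (W : R -> {RV P >-> R}) (c : step_data) :
  wiener_process W -> step_in01 c ->
  (\int[P]_w (step_integral W c w ^+ 2)%:E =
   \int[mu]_(s in `[0%R, 1%R]) (step_fun c s ^+ 2)%:E)%E.
Proof.
move=> WW c01.
pose a (k : 'I_(size c) * bool) : R :=
  (if k.2 then 1 else -1) * (nth (0, (0, 0)) c k.1).1.
pose t (k : 'I_(size c) * bool) : R :=
  let uv := (nth (0, (0, 0)) c k.1).2 in if k.2 then uv.2 else uv.1.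
have t01 k : t k \in `[0, 1].
  have [u0 uv v1] := c01 _ (mem_nth (0, (0, 0)) (ltn_ord k.1)).
  by rewrite in_itv /= /t; case: k.2; apply/andP; split; lra.
have a0 : \sum_k a k = 0.
  transitivity (\sum_i \sum_b a (i, b)).
    by rewrite pair_big /=; apply: eq_bigr => -[].
  by rewrite big1// => i _; rewrite big_bool /a /=; ring.
transitivity (\int[P]_w ((\sum_k a k * W (t k) w) ^+ 2)%:E)%E.
  by apply: eq_integral => w _; rewrite /step_integral (sum_increments c (W ^~ w)).
transitivity (\int[mu]_(x in `[0%R, 1%R])
    ((\sum_k a k * \1_(`]0%R, t k]) x) ^+ 2)%:E)%E; last first.
  apply: eq_integral => x _; rewrite step_funE//.
  by rewrite (sum_increments c (fun t => \1_(`]0%R, t]) x)).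
rewrite (@integral_sqr_zero_sum_combination _ _ _ _ _ _ _ _ (fun i j => `|t i - t j|))//.
- symmetry; apply: (@integral_sqr_zero_sum_combination _ _ _ mu `[0%R, 1%R] _ a
    (fun k => \1_(`]0%R, t k])) (fun i j => `|t i - t j|)) => //.
  by move=> i j; exact: indic_increment_second_moment.
- by move=> i j; exact: wiener_increment_second_moment.
Qed.

End step_isometry.

(** * Passing to the limit in mean square *)

Section square_integral.
Context {R : realType} {d : measure_display} {T : measurableType d}
  (mu : {measure set T -> \bar R}) (D : set T).
Local Open Scope ereal_scope.

(** This replaces the triangle inequality of $L^2$: it involves nonnegative
    integrals only, finite or not, and [e] can be taken arbitrarily small
    after the second term has been made to vanish. *)
Lemma sqr_integral_quasi_triangle (f g : T -> R) (e : R) :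
  measurable D -> measurable_fun D f -> measurable_fun D g -> (0 < e)%R ->
  \int[mu]_(x in D) (f x ^+ 2)%:E <=
  (1 + e)%:E * \int[mu]_(x in D) (g x ^+ 2)%:E +
  (1 + e^-1)%:E * \int[mu]_(x in D) ((f x - g x) ^+ 2)%:E.
Proof.
move=> mD mf mg e0.
have mg2 : measurable_fun D (fun x => (g x ^+ 2)%:E).
  exact/measurable_EFinP/measurable_funX.
have mfg2 : measurable_fun D (fun x => ((f x - g x) ^+ 2)%:E).
  exact/measurable_EFinP/measurable_funX/measurable_funB.
have ge0 (h : T -> R) x : D x -> 0 <= (h x ^+ 2)%:E by rewrite lee_fin sqr_ge0.
have e1 : (0 <= 1 + e)%R by lra.
have e2 : (0 <= 1 + e^-1)%R by rewrite addr_ge0 ?invr_ge0 ?ltW.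
rewrite -!ge0_integralZl_EFin//; [|exact: ge0|exact: ge0].
rewrite -ge0_integralD//; last 4 first.
- by move=> x _; rewrite -EFinM lee_fin mulr_ge0 ?sqr_ge0.
- exact: measurable_funeM.
- by move=> x _; rewrite -EFinM lee_fin mulr_ge0 ?sqr_ge0.
- exact: measurable_funeM.
apply: ge0_le_integral => //.
- by move=> x _; rewrite lee_fin sqr_ge0.
- exact/measurable_EFinP/measurable_funX.
- by apply: emeasurable_funD; exact: measurable_funeM.
move=> x _; rewrite -!EFinM -EFinD lee_fin -subr_ge0.
set a := f x; set b := g x.
have -> : ((1 + e) * b ^+ 2 + (1 + e^-1) * (a - b) ^+ 2 - a ^+ 2 =
   (e * b - (a - b)) ^+ 2 / e)%R by field; rewrite gt_eqF.
by rewrite divr_ge0 ?sqr_ge0 ?ltW.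
Qed.

Lemma sqr_integral_diff_cvg0 (f g : T -> R) (f_ g_ : nat -> T -> R) :
  measurable D -> measurable_fun D f -> (forall n, measurable_fun D (f_ n)) ->
  measurable_fun D g -> (forall n, measurable_fun D (g_ n)) ->
  \int[mu]_(x in D) ((f x - f_ n x) ^+ 2)%:E @[n --> \oo] --> 0 ->
  \int[mu]_(x in D) ((g x - g_ n x) ^+ 2)%:E @[n --> \oo] --> 0 ->
  \int[mu]_(x in D) (((f x - g x) - (f_ n x - g_ n x)) ^+ 2)%:E @[n --> \oo] --> 0.
Proof.
move=> mD mf mf_ mg mg_ f_f g_g.
pose u n := 2%:E * \int[mu]_(x in D) ((f x - f_ n x) ^+ 2)%:E +
            2%:E * \int[mu]_(x in D) ((g x - g_ n x) ^+ 2)%:E.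
have u0 : u n @[n --> \oo] --> 0.
  rewrite [X in _ --> X](_ : 0 = 2%:E * 0 + 2%:E * 0); last by rewrite !mule0 adde0.
  by apply: cvgeD; [rewrite !mule0| |]; try exact: cvgeZl.
apply: (squeeze_cvge _ (cvg_cst 0) u0); apply: nearW => n; apply/andP; split.
  by apply: integral_ge0 => x _; rewrite lee_fin sqr_ge0.
have mfn : measurable_fun D (fun x => f x - f_ n x)%R by exact: measurable_funB.
have mgn : measurable_fun D (fun x => g x - g_ n x)%R by exact: measurable_funB.
have mfg : measurable_fun D (fun x => (f x - g x) - (f_ n x - g_ n x))%R.
  by apply: measurable_funB; exact: measurable_funB.
have := sqr_integral_quasi_triangle mD mfg mfn (@ltr01 R).
rewrite invr1 => /le_trans; apply; rewrite /u leeD//.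
rewrite lee_wpmul2l// le_eqVlt; apply/orP; left; apply/eqP.
by apply: eq_integral => x _; congr EFin; ring.
Qed.

End square_integral.

Section square_integral_limit.
Context {R : realType} {d d' : measure_display} {T : measurableType d}
  {T' : measurableType d'} (mu : {measure set T -> \bar R})
  (nu : {measure set T' -> \bar R}) (D : set T) (E : set T').
Hypotheses (mD : measurable D) (mE : measurable E).
Local Open Scope ereal_scope.

(** Approximations with equal second moments on two different spaces. The
    quasi-triangle inequality, used once on each space, gives
    [F <= (1 + e) ^+ 2 * G] in the limit [n --> \oo], and [e] is then sent
    to zero. *)
Lemma sqr_integral_limit_le (f : T -> R) (f_ : nat -> T -> R)
    (g : T' -> R) (g_ : nat -> T' -> R) :
  measurable_fun D f -> (forall n, measurable_fun D (f_ n)) ->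
  measurable_fun E g -> (forall n, measurable_fun E (g_ n)) ->
  (forall n, \int[mu]_(x in D) (f_ n x ^+ 2)%:E =
             \int[nu]_(x in E) (g_ n x ^+ 2)%:E) ->
  \int[mu]_(x in D) ((f x - f_ n x) ^+ 2)%:E @[n --> \oo] --> 0 ->
  \int[nu]_(x in E) ((g x - g_ n x) ^+ 2)%:E @[n --> \oo] --> 0 ->
  \int[mu]_(x in D) (f x ^+ 2)%:E <= \int[nu]_(x in E) (g x ^+ 2)%:E.
Proof.
move=> mf mf_ mg mg_ fg_ f_f g_g.
set F := \int[mu]_(x in D) (f x ^+ 2)%:E; set G := \int[nu]_(x in E) (g x ^+ 2)%:E.
have G0 : 0 <= G by apply: integral_ge0 => x _; rewrite lee_fin sqr_ge0.
have bound (e : R) : (0 < e)%R -> F <= ((1 + e) ^+ 2)%:E * G.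
  move=> e0; have e1 : (0 <= 1 + e)%R by lra.
  pose u n := (1 + e)%:E * ((1 + e)%:E * G +
     (1 + e^-1)%:E * \int[nu]_(x in E) ((g x - g_ n x) ^+ 2)%:E) +
     (1 + e^-1)%:E * \int[mu]_(x in D) ((f x - f_ n x) ^+ 2)%:E.
  have uF n : F <= u n.
    apply: le_trans (sqr_integral_quasi_triangle mu mD mf (mf_ n) e0) _.
    rewrite /u leeD2r// lee_wpmul2l ?lee_fin// fg_.
    apply: le_trans (sqr_integral_quasi_triangle nu mE (mg_ n) mg e0) _.
    rewrite leeD2l// lee_wpmul2l//; first by rewrite lee_fin addr_ge0 ?invr_ge0 ?ltW.
    by rewrite le_eqVlt; apply/orP; left; apply/eqP; apply: eq_integral => x _;
      congr EFin; ring.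
  have ucvg : u n @[n --> \oo] --> (1 + e)%:E * ((1 + e)%:E * G +
      (1 + e^-1)%:E * 0) + (1 + e^-1)%:E * 0.
    apply: cvgeD; first by rewrite mule0 fin_num_adde_defl.
      apply: cvgeZl => //; apply: cvgeD; first by rewrite mule0 fin_num_adde_defl.
        exact: cvg_cst.
      exact: cvgeZl.
    exact: cvgeZl.
  have -> : ((1 + e) ^+ 2)%:E * G = limn u.
    by rewrite (cvg_lim _ ucvg)// !mule0 !adde0 muleA.
  apply: lime_ge; first by apply/cvg_ex; eexists; exact: ucvg.
  exact: nearW.
have [->|Gfin] := eqVneq G +oo; first by rewrite leey.
have {}Gfin : G \is a fin_num by rewrite ge0_fin_numE// ltey.
apply/lee_addgt0Pr => eps eps0.
move: G0 bound; rewrite -(fineK Gfin) lee_fin; set r := fine G => r0 bound.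
(* With [e <= 1] one has [(1 + e) ^+ 2 <= 1 + 3 * e], so it suffices that
   [e * (3 * r) <= eps]. *)
pose e := (eps / (eps + 3 * (r + 1)))%R.
have den0 : (0 < eps + 3 * (r + 1))%R by lra.
have e0 : (0 < e)%R by rewrite divr_gt0.
have e1 : (e <= 1)%R by rewrite ler_pdivrMr//; lra.
have eeps : (e * (3 * r) <= eps)%R.
  rewrite mulrAC ler_pdivrMr// ler_pM2l//; lra.
apply: le_trans (bound e e0) _; rewrite -EFinM -EFinD lee_fin; nra.
Qed.

End square_integral_limit.

Lemma sqr_integral_limit {R : realType} {d d' : measure_display}
    {T : measurableType d} {T' : measurableType d'}
    (mu : {measure set T -> \bar R}) (nu : {measure set T' -> \bar R})
    (D : set T) (E : set T') (f : T -> R) (f_ : nat -> T -> R)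
    (g : T' -> R) (g_ : nat -> T' -> R) :
  measurable D -> measurable E -> measurable_fun D f -> (forall n, measurable_fun D (f_ n)) ->
  measurable_fun E g -> (forall n, measurable_fun E (g_ n)) ->
  (forall n, \int[mu]_(x in D) (f_ n x ^+ 2)%:E =
             \int[nu]_(x in E) (g_ n x ^+ 2)%:E)%E ->
  (\int[mu]_(x in D) ((f x - f_ n x) ^+ 2)%:E @[n --> \oo] --> 0)%E ->
  (\int[nu]_(x in E) ((g x - g_ n x) ^+ 2)%:E @[n --> \oo] --> 0)%E ->
  (\int[mu]_(x in D) (f x ^+ 2)%:E = \int[nu]_(x in E) (g x ^+ 2)%:E)%E.
Proof.
move=> mD mE mf mf_ mg mg_ fg_ f_f g_g; apply/eqP; rewrite eq_le; apply/andP; split.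
  exact: (sqr_integral_limit_le mD mE mf mf_ mg mg_).
by apply: (sqr_integral_limit_le mE mD mg mg_ mf mf_) => // n; rewrite fg_.
Qed.

(** * The Wiener isometry *)

Section wiener_isometry.
Context {R : realType} {d : measure_display} {T : measurableType d}
  (P : probability T R) (W : R -> {RV P >-> R}).
Local Notation mu := (@lebesgue_measure R).

Definition step_diff (c c' : @step_data R) : step_data :=
  c ++ [seq (- p.1, p.2) | p <- c'].

Lemma step_diff_in01 (c c' : step_data) :
  step_in01 c -> step_in01 c' -> step_in01 (step_diff c c').
Proof.
move=> c01 c01' p; rewrite mem_cat => /orP[/c01//|/mapP[q /c01' qc ->]].
exact: qc.
Qed.

Lemma step_fun_diff (c c' : step_data) (s : R) :
  step_fun (step_diff c c') s = step_fun c s - step_fun c' s.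
Proof.
rewrite /step_fun big_cat big_map /= -sumrN; congr (_ + _).
by apply: eq_bigr => p _; rewrite mulNr.
Qed.

Lemma step_integral_diff (c c' : step_data) (w : T) :
  step_integral W (step_diff c c') w = step_integral W c w - step_integral W c' w.
Proof.
rewrite /step_integral big_cat big_map /= -sumrN; congr (_ + _).
by apply: eq_bigr => p _; rewrite mulNr.
Qed.

Lemma measurable_step_fun (c : @step_data R) (D : set (measurableTypeR R)) :
  measurable_fun D (step_fun c).
Proof.
rewrite /step_fun; apply: measurable_sum => p; apply: measurable_funM => //.
Qed.

Lemma measurable_step_integral (c : step_data) :
  measurable_fun [set: T] (step_integral W c).
Proof.
rewrite /step_integral; apply: measurable_sum => p; apply: measurable_funM => //.
exact: measurable_funB.
Qed.

Lemma is_wiener_integral01_0 : is_wiener_integral01 W (cst 0) (cst 0 : {RV P >-> R}).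
Proof.
split.
- exact: measurable_cst.
- by apply: eq_integrable (integrable0 _ _) => // s _; rewrite /= expr0n.
exists (fun=> [::]); split => //.
- under eq_fun.
    move=> n; under eq_integral do rewrite /step_fun big_nil subr0 expr0n.
    rewrite integral0; over.
  exact: cvg_cst.
- under eq_fun.
    move=> n; rewrite unlock.
    under eq_integral do rewrite /step_integral big_nil subr0 expr0n.
    rewrite integral0; over.
  exact: cvg_cst.
Qed.

(** The difference of two step integrals is a step integral, so the isometry
    on step functions applies to the differences of the approximations. *)
Lemma wiener_isometryB (f g : R -> R) (X Y : {RV P >-> R}) :
  wiener_process W ->
  is_wiener_integral01 W f X -> is_wiener_integral01 W g Y ->
  (\int[P]_w ((X w - Y w) ^+ 2)%:E =
   \int[mu]_(s in `[0%R, 1%R]) ((f s - g s) ^+ 2)%:E)%E.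
Proof.
move=> WW [mf _ [c [c01 cf cX]]] [mg _ [c' [c01' cg cY]]].
rewrite unlock in cX; rewrite unlock in cY.
have {}mf : measurable_fun (`[0, 1] : set (measurableTypeR R)) f by exact: mf.
have {}mg : measurable_fun (`[0, 1] : set (measurableTypeR R)) g by exact: mg.
have mX : measurable_fun [set: T] X by exact: measurable_funPT.
have mY : measurable_fun [set: T] Y by exact: measurable_funPT.
pose I n := step_integral W (step_diff (c n) (c' n)).
pose F n := step_fun (step_diff (c n) (c' n)).
apply: (@sqr_integral_limit R _ _ T (measurableTypeR R) P mu setT `[0, 1]
  (X \- Y) I (f \- g) F) => //.
- by move=> n; exact: measurable_step_integral.
- exact: measurable_funB.
- by move=> n; exact: measurable_step_fun.
- by move=> n; apply: step_isometry => //; exact: step_diff_in01.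
- under eq_fun do under eq_integral do rewrite /I step_integral_diff.
  apply: sqr_integral_diff_cvg0 => // n; exact: measurable_step_integral.
- under eq_fun do under eq_integral do rewrite /F step_fun_diff.
  apply: sqr_integral_diff_cvg0 => // n; exact: measurable_step_fun.
Qed.

Lemma wiener_isometry (f : R -> R) (X : {RV P >-> R}) :
  wiener_process W -> is_wiener_integral01 W f X ->
  (\int[P]_w (X w ^+ 2)%:E = \int[mu]_(s in `[0%R, 1%R]) (f s ^+ 2)%:E)%E.
Proof.
move=> WW fX; have := wiener_isometryB WW fX is_wiener_integral01_0.
under eq_integral do rewrite subr0.
by under [in X in _ = X -> _]eq_integral do rewrite subr0.
Qed.

End wiener_isometry.

(** * Affine changes of variables and integrals of powers *)

Section affine_change_of_variables.
Context {R : realType}.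
Local Notation mu := (@lebesgue_measure R).

(** The image of the Lebesgue measure under [x |-> r * x + c], multiplied by
    [`|r|], gives each half-open interval its length; such a measure is the
    Lebesgue measure. *)
Lemma ge0_integral_affine (f : R -> \bar R) (r c : R) : r != 0 ->
  measurable_fun [set: R] f -> (forall x, 0 <= f x)%E ->
  (\int[mu]_x f x = `|r|%:E * \int[mu]_x f (r * x + c)%R)%E.
Proof.
move=> r0 mf f0.
pose phi : measurableTypeR R -> measurableTypeR R := fun x => r * x + c.
have mphi : measurable_fun [set: measurableTypeR R] phi.
  by apply: measurable_funD => //; exact: measurable_funM.
have k0 : 0 <= `|r| by [].
pose m := mscale (NngNum k0) (pushforward mu phi).
have -> : (\int[mu]_x f x = \int[m mphi]_x f x)%E.
  apply: eq_measure_integral => A mA _; apply: lebesgue_measure_unique => //.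
  move=> _ [[a b] _ <-].
  rewrite /m /= /mscale /= /pushforward /=.
  have [ab|ba] := ltP a b; last first.
    by rewrite set_itv_ge ?bnd_simp -?leNgt// preimage_set0 !measure0 mule0.
  have [r_gt0|r_lt0|/eqP] := ltgtP 0 r; last by rewrite eq_sym (negbTE r0).
    have -> : phi @^-1` `]a, b] = `](a - c) / r, (b - c) / r]%classic.
      apply/seteqP; split => x /=; rewrite !in_itv /= /phi ltr_pdivrMr// ler_pdivlMr//;
        by rewrite ltrBlDr lerBrDr (mulrC x).
    rewrite !lebesgue_measure_itv /= !lte_fin ltr_pM2r ?invr_gt0// ltrD2r ab.
    rewrite -!EFinB -EFinM gtr0_norm//; congr EFin.
    by field.
  have -> : phi @^-1` `]a, b] = `[(b - c) / r, (a - c) / r[%classic.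
    apply/seteqP; split => x /=; rewrite !in_itv /= /phi ler_ndivrMr// ltr_ndivlMr//;
      by rewrite ltrBlDr lerBrDr (mulrC x) andbC.
  rewrite !lebesgue_measure_itv /= !lte_fin ltr_nM2r ?invr_lt0// ltrD2r ab.
  rewrite -!EFinB -EFinM ltr0_norm//; congr EFin.
  by field.
rewrite ge0_integral_mscale//; congr (_ * _)%E.
by rewrite ge0_integral_pushforward.
Qed.

End affine_change_of_variables.

Section power_integrals.
Context {R : realType}.
Local Notation mu := (@lebesgue_measure R).

Lemma continuous_powR (p x : R) : 0 < x -> {for x, continuous (@powR R ^~ p)}.
Proof.
move=> x0; apply: differentiable_continuous; apply/derivable1_diffP.
by have [] := @is_derive1_powR R p x x0.
Qed.

Lemma integral_powR_cc (p a b : R) : p + 1 != 0 -> 0 < a -> a < b ->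
  (\int[mu]_(x in `[a, b]) (x `^ p)%:E =
   (b `^ (p + 1) / (p + 1) - a `^ (p + 1) / (p + 1))%:E)%E.
Proof.
move=> p1 a0 ab.
have d (x : R) : 0 < x -> is_derive x 1 (fun x : R => x `^ (p + 1) / (p + 1)) (x `^ p).
  move=> x0; have := @is_derive1_powR R (p + 1) x x0; rewrite addrK => ?.
  by apply: is_derive_eq; rewrite /GRing.scale /=; field.
have c (x : R) : 0 < x -> {for x, continuous (fun x : R => x `^ (p + 1) / (p + 1))}.
  move=> /d xd; apply: differentiable_continuous; apply/derivable1_diffP.
  exact: ex_derive.
rewrite (@continuous_FTC2 _ _ (fun x : R => x `^ (p + 1) / (p + 1)))//.
- apply: continuous_in_subspaceT => x; rewrite inE /= in_itv /= => /andP[ax _].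
  by apply: continuous_powR; exact: lt_le_trans ax.
- split.
  + move=> x; rewrite in_itv /= => /andP[ax _].
    by have [] := d x (lt_trans a0 ax).
  + by apply: cvg_at_right_filter; exact: c.
  + by apply: cvg_at_left_filter; apply: c; exact: lt_trans ab.
- move=> x; rewrite in_itv /= => /andP[ax _]; rewrite derive1E.
  by have [_ ->] := d x (lt_trans a0 ax).
Qed.

(** For [p < 0] the integrand is unbounded at [0], so the fundamental theorem
    of calculus is applied on [`[t / n.+2, t]] and monotone convergence gives
    the integral over [`]0, t]]. *)
Lemma integral_powR (p t : R) : -1 < p -> 0 < t ->
  (\int[mu]_(x in `]0%R, t[) (x `^ p)%:E = (t `^ (p + 1) / (p + 1))%:E)%E.
Proof.
move=> p1 t0; have q0 : 0 < p + 1 by lra.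
have mpow : measurable_fun [set: R] (fun x : R => (x `^ p)%:E).
  by apply/measurable_EFinP; exact: measurable_powR.
rewrite integral_itv_bndo_bndc; last exact: measurable_funTS.
pose F n := `[t / n.+2%:R, t]%classic : set R.
have FE : \bigcup_n F n = `]0, t]%classic.
  apply/seteqP; split => x /=.
    move=> [n _]; rewrite /F /= !in_itv /= => /andP[nx ->]; rewrite andbT.
    by apply: lt_le_trans nx; rewrite divr_gt0.
  rewrite in_itv /= => /andP[x0 xt].
  have [n nx] : exists n, t / x < n%:R.
    by exists (Num.truncn (t / x)).+1; exact: truncnS_gt.
  exists n => //; rewrite /F /= in_itv /= xt andbT ler_pdivrMr//.
  rewrite mulrC -ler_pdivrMr//; apply: (le_trans (ltW nx)).
  by rewrite ler_nat; exact: leq_trans (leqnSn _).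
have ndF : nondecreasing_seq F.
  apply/nondecreasing_seqP => n; apply/subsetPset => x.
  rewrite /F /= !in_itv /= => /andP[nx ->]; rewrite andbT.
  by apply: le_trans nx; rewrite ler_pM2l// lef_pV2 ?posrE// ler_nat.
have := @ge0_nondecreasing_set_cvg_integral _ (measurableTypeR R) R F (fun x => (x `^ p)%:E) mu ndF.
rewrite FE => /(_ (fun=> measurable_itv _)).
move=> /(_ (fun=> measurable_funTS mpow)).
move=> /(_ (fun _ x _ => _)) Fcvg.
have {}Fcvg := Fcvg (fun x => powR_ge0 x p).
apply: (cvg_unique _ Fcvg) => //.
rewrite (_ : (fun _ => _) = fun n => (t `^ (p + 1) / (p + 1) -
    (t / n.+2%:R) `^ (p + 1) / (p + 1))%:E); last first.
  apply/funext => n; rewrite integral_powR_cc ?gt_eqF ?divr_gt0//.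
  by rewrite ltr_pdivrMr// ltr_pMr// ltr1n.
apply: cvg_EFin; first exact: nearW.
rewrite -[X in _ --> X]subr0; apply: cvgB; first exact: cvg_cst.
rewrite -[X in _ --> X](mul0r (p + 1)^-1); apply: cvgM; last exact: cvg_cst.
have /cvg_at_rightP := powR_cvg0 q0; apply; split.
  by move=> n; rewrite divr_gt0.
rewrite -[X in _ --> X](mulr0 t); apply: cvgM; first exact: cvg_cst.
have := @cvg_harmonic R; rewrite -(cvg_shiftS) /=; exact.
Qed.

Lemma integral_powR_shift (p s t : R) : -1 < p -> s < t ->
  (\int[mu]_(u in `]s, t[) ((u - s) `^ p)%:E = ((t - s) `^ (p + 1) / (p + 1))%:E)%E.
Proof.
move=> p1 st; rewrite -integral_powR ?subr_gt0//.
rewrite integral_mkcond [RHS]integral_mkcond.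
have mpow : measurable_fun [set: R] (fun x : R => ((x - s) `^ p)%:E).
  apply/measurable_EFinP; apply: (measurableT_comp (measurable_powR p)).
  exact: measurable_funB.
rewrite (@ge0_integral_affine _ _ 1 s)//; last 2 first.
- exact/(measurable_restrictT _ (measurable_itv _))/measurable_funTS.
- by move=> x; rewrite patchE; case: ifP => // _; rewrite lee_fin powR_ge0.
rewrite normr1 mul1e; apply: eq_integral => x _.
rewrite !patchE mul1r !mem_setE !in_itv /= addrK ltrDr -ltrBrDr.
by [].
Qed.

Lemma integral_powR_reflect (p t : R) : -1 < p -> 0 < t ->
  (\int[mu]_(u in `]0%R, t[) ((t - u) `^ p)%:E = (t `^ (p + 1) / (p + 1))%:E)%E.
Proof.
move=> p1 t0; rewrite -integral_powR//.
rewrite integral_mkcond [RHS]integral_mkcond.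
have mpow : measurable_fun [set: R] (fun x : R => ((t - x) `^ p)%:E).
  apply/measurable_EFinP; apply: (measurableT_comp (measurable_powR p)).
  exact: measurable_funB.
rewrite (@ge0_integral_affine _ _ (-1) t)//; last 2 first.
- exact/(measurable_restrictT _ (measurable_itv _))/measurable_funTS.
- by move=> x; rewrite patchE; case: ifP => // _; rewrite lee_fin powR_ge0.
rewrite normrN1 mul1e; apply: eq_integral => x _.
rewrite !patchE mulN1r !mem_setE !in_itv /= opprD opprK addrCA subrr addr0.
by rewrite addrC subr_gt0 ltrBlDr ltrDl andbC.
Qed.

End power_integrals.

(** * Beta integrals *)

Section beta_integral.
Context {R : realType}.
Local Notation mu := (@lebesgue_measure R).

Lemma measurable_powR_comp {d} {T : measurableType d} (D : set T) (f : T -> R) (p : R) :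
  measurable_fun D f -> measurable_fun D (fun x => f x `^ p).
Proof. by move=> mf; exact: (measurableT_comp (measurable_powR p)). Qed.

Lemma measurable_beta_integrand (t a b : R) (D : set (measurableTypeR R)) :
  measurable_fun D (fun x : R => (x `^ a * (t - x) `^ b)%:E).
Proof.
apply/measurable_EFinP; apply: measurable_funM.
  by apply: measurable_powR_comp; exact: measurable_id.
by apply: measurable_powR_comp; exact: measurable_funB.
Qed.

(** The point is finiteness: the first factor is at most [1] since [1 <= a], and
    the second one is integrable since [0 < b]. *)
Lemma BetaE (a b : R) : 1 <= a -> 0 < b ->
  (\int[mu]_(x in `]0%R, 1%R[) (x `^ (a - 1) * (1 - x) `^ (b - 1))%:E =
   (Beta a b)%:E)%E.
Proof.
move=> a1 b0; rewrite fineK// ge0_fin_numE; last first.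
  by apply: integral_ge0 => x _; rewrite lee_fin mulr_ge0 ?powR_ge0.
apply: (@le_lt_trans _ _ (\int[mu]_(x in `]0%R, 1%R[) ((1 - x) `^ (b - 1))%:E)%E).
  apply: ge0_le_integral => //.
  - by move=> x _; rewrite lee_fin mulr_ge0 ?powR_ge0.
  - exact: measurable_beta_integrand.
  - apply/measurable_EFinP/measurable_powR_comp; exact: measurable_funB.
  - move=> x /=; rewrite in_itv /= => /andP[x0 x1].
    rewrite lee_fin ler_piMl ?powR_ge0//.
    by rewrite -[leRHS](powRr0 x); apply: ger_powR; [rewrite x0 ltW|lra].
by rewrite integral_powR_reflect ?ltry//; lra.
Qed.

Lemma Beta_ge0 (a b : R) : 0 <= Beta a b.
Proof. by apply: Rintegral_ge0 => x _; rewrite mulr_ge0 ?powR_ge0. Qed.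

Lemma integral_beta_scale (t a b : R) : 0 < t -> 1 <= a -> 0 < b ->
  (\int[mu]_(x in `]0%R, t[) (x `^ (a - 1) * (t - x) `^ (b - 1))%:E =
   (t `^ (a + b - 1) * Beta a b)%:E)%E.
Proof.
move=> t0 a1 b0; rewrite EFinM -BetaE//.
rewrite integral_mkcond (@ge0_integral_affine _ _ t 0) ?gt_eqF//; last 2 first.
- apply/(measurable_restrictT _ (measurable_itv _)).
  exact: measurable_beta_integrand.
- move=> x; rewrite patchE; case: ifP => // _.
  by rewrite lee_fin mulr_ge0 ?powR_ge0.
rewrite gtr0_norm//.
have -> : (t `^ (a + b - 1))%:E = (t%:E * (t `^ (a + b - 2))%:E)%E.
  rewrite -EFinM -{2}(powRr1 (ltW t0)) -powRD ?(gt_eqF t0) ?implybT//.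
  by congr (_ `^ _)%:E; ring.
rewrite -muleA; congr (_ * _)%E.
rewrite -ge0_integralZl_EFin ?powR_ge0//; last 2 first.
- by move=> x _; rewrite lee_fin mulr_ge0 ?powR_ge0.
- exact: measurable_beta_integrand.
rewrite [RHS]integral_mkcond; apply: eq_integral => x _.
rewrite !patchE !mem_setE !in_itv /= addr0 pmulr_rgt0// gtr_pMr//.
case: ifP => // /andP[x0 x1].
rewrite -EFinM; congr EFin.
have -> : t - t * x = t * (1 - x) by ring.
rewrite !powRM ?subr_ge0 ?ltW//.
have -> : t `^ (a + b - 2) = t `^ (a - 1) * t `^ (b - 1).
  rewrite -powRD ?(gt_eqF t0) ?implybT//; congr (_ `^ _); ring.
by ring.
Qed.

(** Exchanging the order of integration, the inner integral becomes a scaled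
    beta integral over [`]0, u[], that is, a multiple of a power of [u], and
    the outer one an integral of a power. *)
Lemma integral_beta_double (t q h : R) : 0 < t -> 0 <= q -> -1 < h ->
  0 < q + 2 * h + 1 ->
  (\int[mu]_(s in `]0%R, t[) (\int[mu]_(u in `]s, t[)
     (s `^ q * (u `^ (h - 1) * (u - s) `^ h))%:E) =
   (Beta (q + 1) (h + 1) * (t `^ (q + 2 * h + 1) / (q + 2 * h + 1)))%:E)%E.
Proof.
move=> t0 q0 h1 r0.
pose f (s u : R) := (s `^ q * (u `^ (h - 1) * (u - s) `^ h))%:E.
have f0 s u : (0 <= f s u)%E by rewrite lee_fin !mulr_ge0 ?powR_ge0.
have mf : measurable_fun [set: R * R] (fun z => f z.1 z.2).
  apply/measurable_EFinP; apply: measurable_funM.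
    by apply: measurable_powR_comp; exact: measurable_fst.
  apply: measurable_funM; apply: measurable_powR_comp.
    exact: measurable_snd.
  by apply: measurable_funB; [exact: measurable_snd|exact: measurable_fst].
transitivity (\int[mu]_(s in `]0%R, t[) \int[mu]_(u in `]0%R, t[ `&` `]s, +oo[) f s u)%E.
  apply: eq_integral => s; rewrite inE /= in_itv /= => /andP[s0 st].
  congr (integral _ _ _); apply/seteqP; split => u /=; rewrite !in_itv /= ?andbT.
    by move=> /andP[su ->]; rewrite su (lt_trans s0 su).
  by move=> [/andP[_ ->] ->].
rewrite tonelli_triangle//.
transitivity (\int[mu]_(u in `]0%R, t[)
    ((Beta (q + 1) (h + 1))%:E * (u `^ (q + 2 * h))%:E))%E.
  apply: eq_integral => u; rewrite inE /= in_itv /= => /andP[u0 ut].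
  have -> : `]0, t[ `&` `]-oo, u[ = `]0, u[%classic :> set R.
    apply/seteqP; split => s /=; rewrite !in_itv /=.
      by move=> [/andP[-> _] ->].
    by move=> /andP[-> su]; rewrite su (lt_trans su ut).
  transitivity (\int[mu]_(s in `]0%R, u[)
      ((u `^ (h - 1))%:E * (s `^ (q + 1 - 1) * (u - s) `^ (h + 1 - 1))%:E))%E.
    apply: eq_integral => s _; rewrite /f -EFinM !addrK; congr EFin; ring.
  rewrite ge0_integralZl_EFin ?powR_ge0//; last 2 first.
  - by move=> x _; rewrite lee_fin mulr_ge0 ?powR_ge0.
  - exact: measurable_beta_integrand.
  rewrite integral_beta_scale//; [|lra|lra].
  rewrite -!EFinM; congr EFin; rewrite mulrA -powRD ?(gt_eqF u0) ?implybT//.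
  by rewrite mulrC; congr (_ * _ `^ _); ring.
rewrite ge0_integralZl_EFin ?Beta_ge0//; last 2 first.
- by move=> x _; rewrite lee_fin powR_ge0.
- by apply/measurable_EFinP/measurable_powR_comp; exact: measurable_id.
by rewrite integral_powR//; lra.
Qed.

End beta_integral.

(** * The Molchan kernel against a power *)

Section cross_moment.
Context {R : realType} (H : R).
Local Notation mu := (@lebesgue_measure R).

(** On [`]s, t[] the factor [u `^ (H - 3 / 2)] is bounded by its value at [s],
    and [(u - s) `^ (H - 1 / 2)] is integrable; hence the real-valued integral
    in the kernel is the genuine one. *)
Lemma integral_molchan_inner (s t : R) : 0 < H -> H < 1 / 2 -> 0 < s -> s < t ->
  (\int[mu]_(u in `]s, t[) (u `^ (H - 3 / 2) * (u - s) `^ (H - 1 / 2))%:E =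
   (\int[mu]_(u in `]s, t[) (u `^ (H - 3 / 2) * (u - s) `^ (H - 1 / 2)))%:E)%E.
Proof.
move=> H_gt0 H_lt12 s0 st; have e0 : 0 <= 3 / 2 - H by lra.
rewrite fineK// ge0_fin_numE; last first.
  by apply: integral_ge0 => x _; rewrite lee_fin mulr_ge0 ?powR_ge0.
apply: (@le_lt_trans _ _ (\int[mu]_(u in `]s, t[)
    ((s `^ (H - 3 / 2))%:E * ((u - s) `^ (H - 1 / 2))%:E))%E).
  have msub : measurable_fun [set: measurableTypeR R] (fun u : R => (u - s) `^ (H - 1 / 2)).
    by apply: measurable_powR_comp; exact: measurable_funB.
  apply: ge0_le_integral => //.
  - by move=> x _; rewrite lee_fin mulr_ge0 ?powR_ge0.
  - apply/measurable_EFinP/measurable_funTS/measurable_funM => //.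
  - by apply: measurable_funeM; exact/measurable_EFinP/measurable_funTS.
  - move=> u /=; rewrite in_itv /= => /andP[su ut].
    rewrite -EFinM lee_fin ler_wpM2r ?powR_ge0//.
    have -> : H - 3 / 2 = - (3 / 2 - H) by ring.
    rewrite !powRN lef_pV2 ?posrE ?powR_gt0//; last exact: lt_trans su.
    by apply: ge0_ler_powR; rewrite ?nnegrE; [exact: e0|exact: ltW|exact/ltW/(lt_trans s0)|exact: ltW].
rewrite ge0_integralZl_EFin ?powR_ge0//; last 2 first.
- by move=> x _; rewrite lee_fin powR_ge0.
- by apply/measurable_EFinP/measurable_powR_comp; exact: measurable_funB.
by rewrite integral_powR_shift//; [rewrite -EFinM ltry|lra].
Qed.

(** The two terms of the kernel contribute the same beta factor with weights
    [1] and [(1 / 2 - H) / (gamma + 1 / 2 + H)], whose sum is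
    [(gamma + 1) / (gamma + 1 / 2 + H)]. *)
Lemma integral_molchan_power (t gamma : R) : 0 < H -> H < 1 / 2 -> 0 < t -> 0 < gamma ->
  (\int[mu]_(s in `]0%R, t[) (molchan_kernel H t s * s `^ gamma)%:E =
   (molchan_const H * Beta (gamma - H + 3 / 2) (H + 1 / 2) *
    ((gamma + 1) / (gamma + 1 / 2 + H)) * t `^ (gamma + 1 / 2 + H))%:E)%E.
Proof.
move=> H_gt0 H_lt12 t0 g0.
set c := molchan_const H; set b := Beta _ _.
have c0 : 0 <= c by exact: sqrtr_ge0.
pose q := gamma + 1 / 2 - H.
pose f (s u : R) := (s `^ q * (u `^ (H - 1 / 2 - 1) * (u - s) `^ (H - 1 / 2)))%:E.
have f0 s u : (0 <= f s u)%E by rewrite lee_fin !mulr_ge0 ?powR_ge0.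
pose F s := (\int[mu]_(u in `]s, t[) f s u)%E.
have F0 s : (0 <= F s)%E by apply: integral_ge0 => u _; exact: f0.
have mf : measurable_fun [set: R * R] (fun z => f z.1 z.2).
  apply/measurable_EFinP; apply: measurable_funM.
    by apply: measurable_powR_comp; exact: measurable_fst.
  apply: measurable_funM; apply: measurable_powR_comp.
    exact: measurable_snd.
  by apply: measurable_funB; [exact: measurable_snd|exact: measurable_fst].
have mF : measurable_fun (`]0, t[ : set (measurableTypeR R)) F.
  apply: eq_measurable_fun (measurable_integral_triangle (measurable_itv _) mf f0).
  move=> s; rewrite inE /= in_itv /= => /andP[s0 st].
  congr (integral _ _ _); apply/seteqP; split => u /=; rewrite !in_itv /= ?andbT.
    by move=> [/andP[_ ->] ->].
  by move=> /andP[su ->]; rewrite su (lt_trans s0 su).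
transitivity (\int[mu]_(s in `]0%R, t[) (c%:E *
    ((t `^ (H - 1 / 2))%:E * (s `^ (q + 1 - 1) * (t - s) `^ (H + 1 / 2 - 1))%:E +
     (1 / 2 - H)%:E * F s)))%E.
  apply: eq_integral => s; rewrite inE /= in_itv /= => /andP[s0 st].
  have -> : F s = (s `^ q * \int[mu]_(u in `]s, t[)
      (u `^ (H - 3 / 2) * (u - s) `^ (H - 1 / 2)))%:E.
    rewrite /F EFinM -integral_molchan_inner// -ge0_integralZl_EFin ?powR_ge0//.
    - by apply: eq_integral => u _; rewrite -EFinM /f; congr (_ * (_ `^ _ * _))%:E; field.
    - by move=> u _; rewrite lee_fin mulr_ge0 ?powR_ge0.
    - apply/measurable_EFinP/measurable_funM; apply: measurable_powR_comp.
        exact: measurable_id.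
      exact: measurable_funB.
  rewrite -EFinM; congr EFin; rewrite /molchan_kernel -/c.
  set I := (X in _ - _ * X); set J := (X in _ + _ * (_ * X)).
  have -> : I = J by [].
  have -> : s `^ q = s `^ (1 / 2 - H) * s `^ gamma.
    by rewrite -powRD ?(gt_eqF s0) ?implybT//; congr (_ `^ _); rewrite /q; ring.
  rewrite addrK.
  have -> : s `^ q = s `^ (1 / 2 - H) * s `^ gamma.
    by rewrite -powRD ?(gt_eqF s0) ?implybT//; congr (_ `^ _); rewrite /q; ring.
  have -> : H + 1 / 2 - 1 = H - 1 / 2 by field.
  by ring.
rewrite ge0_integralZl_EFin//; last 2 first.
- by move=> s _; rewrite adde_ge0 ?mule_ge0// lee_fin ?mulr_ge0 ?powR_ge0//; lra.
- apply: emeasurable_funD; apply: measurable_funeM => //.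
  exact: measurable_beta_integrand.
rewrite ge0_integralD//; last 4 first.
- by move=> s _; rewrite mule_ge0// lee_fin ?mulr_ge0 ?powR_ge0.
- by apply: measurable_funeM; exact: measurable_beta_integrand.
- by move=> s _; rewrite mule_ge0// lee_fin; lra.
- exact: measurable_funeM.
rewrite ge0_integralZl_EFin ?powR_ge0//; last 2 first.
- by move=> s _; rewrite lee_fin mulr_ge0 ?powR_ge0.
- exact: measurable_beta_integrand.
rewrite ge0_integralZl_EFin//; last lra.
rewrite integral_beta_scale//; [|rewrite /q; lra|lra].
rewrite integral_beta_double//; [|rewrite /q; lra|lra|rewrite /q; lra].
rewrite -EFinM; congr EFin.
have -> : Beta (q + 1) (H - 1 / 2 + 1) = b by rewrite /b /q; congr Beta; field.
have -> : Beta (q + 1) (H + 1 / 2) = b by rewrite /b /q; congr Beta; field.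
have -> : q + 2 * (H - 1 / 2) + 1 = gamma + 1 / 2 + H by rewrite /q; field.
rewrite (mulrA (t `^ _)) -powRD ?(gt_eqF t0) ?implybT//.
have -> : H - 1 / 2 + (q + 1 + (H + 1 / 2) - 1) = gamma + 1 / 2 + H.
  by rewrite /q; field.
by field; rewrite gt_eqF//; lra.
Qed.

End cross_moment.

(** * The maximum of the distance as a function of time *)

Section profile.
Context {R : realType}.
Implicit Types A H gamma t : R.

(** The mean square distance at time [t], where [A] stands for
    [c_H * B (gamma - H + 3 / 2, H + 1 / 2) * (gamma + 1)]. *)
Definition profile A H gamma t :=
  t `^ (2 * H) - 2 * (A / (gamma + 1 / 2 + H)) * t `^ (gamma + 1 / 2 + H)
  + t `^ (2 * gamma + 1) / (2 * gamma + 1).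

Lemma profile0 A H gamma : 0 < H -> 0 < gamma -> profile A H gamma 0 = 0.
Proof.
move=> H0 g0; rewrite /profile !powR0; [by ring|..]; rewrite gt_eqF//; lra.
Qed.

Lemma profile1 A H gamma :
  profile A H gamma 1 = 1 - 2 * (A / (gamma + 1 / 2 + H)) + 1 / (2 * gamma + 1).
Proof. by rewrite /profile !powR1 mulr1. Qed.

Lemma profile_factor A H gamma t : 0 < t ->
  profile A H gamma t = t `^ (2 * H) *
    (1 - 2 * (A / (gamma + 1 / 2 + H)) * t `^ (gamma - H + 1 / 2)
     + t `^ (gamma - H + 1 / 2) ^+ 2 / (2 * gamma + 1)).
Proof.
move=> t0; rewrite /profile.
have tD r s : t `^ (r + s) = t `^ r * t `^ s by rewrite powRD ?(gt_eqF t0) ?implybT.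
have -> : gamma + 1 / 2 + H = 2 * H + (gamma - H + 1 / 2) by field.
have -> : t `^ (2 * gamma + 1) =
    t `^ (2 * H + ((gamma - H + 1 / 2) + (gamma - H + 1 / 2))).
  by congr (_ `^ _); field.
by rewrite !tD; ring.
Qed.

(** Up to a positive factor the derivative is the quadratic polynomial
    [x ^+ 2 - 2 * A * x + 2 * H] in [x = t `^ (gamma - H + 1 / 2)]. *)
Lemma is_derive_profile A H gamma t : 0 < H -> 0 < gamma -> 0 < t ->
  is_derive t 1 (profile A H gamma)
    (t `^ (2 * H - 1) * (t `^ (gamma - H + 1 / 2) ^+ 2
       - 2 * A * t `^ (gamma - H + 1 / 2) + 2 * H)).
Proof.
move=> H0 g0 t0.
have tD r s : t `^ (r + s) = t `^ r * t `^ s by rewrite powRD ?(gt_eqF t0) ?implybT.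
have d1 := @is_derive1_powR R (2 * H) t t0.
have d2 := @is_derive1_powR R (gamma + 1 / 2 + H) t t0.
have d3 := @is_derive1_powR R (2 * gamma + 1) t t0.
apply: is_derive_eq; rewrite /GRing.scale /=.
have -> : gamma + 1 / 2 + H - 1 = 2 * H - 1 + (gamma - H + 1 / 2) by field.
have -> : 2 * gamma + 1 - 1 =
    2 * H - 1 + ((gamma - H + 1 / 2) + (gamma - H + 1 / 2)) by field.
rewrite !tD; field.
by apply/andP; split; rewrite gt_eqF//; lra.
Qed.

Lemma profile_nondecreasing A H gamma (a b : R) :
  0 < H -> 0 < gamma -> 0 < a -> a <= b ->
  (forall t, a < t < b -> 0 <= t `^ (gamma - H + 1 / 2) ^+ 2
      - 2 * A * t `^ (gamma - H + 1 / 2) + 2 * H) ->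
  profile A H gamma a <= profile A H gamma b.
Proof.
move=> H0 g0 a0 ab quad.
have d t : a <= t -> is_derive t 1 (profile A H gamma) _ :=
  fun at_ => is_derive_profile A H0 g0 (lt_le_trans a0 at_).
apply: (@ger0_derive1_le_cc _ _ a b) => //; rewrite ?in_itv /= ?lexx ?ab//.
- by move=> t; rewrite in_itv /= => /andP[/ltW/d []].
- move=> t; rewrite in_itv /= => /andP[ta tb]; rewrite derive1E.
  have [_ ->] := d t (ltW ta); rewrite mulr_ge0 ?powR_ge0// quad//.
  by rewrite ta.
- by apply: derivable_within_continuous => t; rewrite in_itv /= => /andP[/d[]].
Qed.

Lemma profile_nonincreasing A H gamma (a b : R) :
  0 < H -> 0 < gamma -> 0 < a -> a <= b ->
  (forall t, a < t < b -> t `^ (gamma - H + 1 / 2) ^+ 2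
      - 2 * A * t `^ (gamma - H + 1 / 2) + 2 * H <= 0) ->
  profile A H gamma b <= profile A H gamma a.
Proof.
move=> H0 g0 a0 ab quad.
have d t : a <= t -> is_derive t 1 (profile A H gamma) _ :=
  fun at_ => is_derive_profile A H0 g0 (lt_le_trans a0 at_).
apply: (@ler0_derive1_le_cc _ _ a b) => //; rewrite ?in_itv /= ?lexx ?ab//.
- by move=> t; rewrite in_itv /= => /andP[/ltW/d []].
- move=> t; rewrite in_itv /= => /andP[ta tb]; rewrite derive1E.
  have [_ ->] := d t (ltW ta); rewrite mulr_ge0_le0 ?powR_ge0// quad//.
  by rewrite ta.
- by apply: derivable_within_continuous => t; rewrite in_itv /= => /andP[/d[]].
Qed.

(** The smaller root of [x ^+ 2 - 2 * A * x + 2 * H], when it has real roots. *)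
Definition small_root A H := A - Num.sqrt (A ^+ 2 - 2 * H).

Definition critical_time A H gamma := small_root A H `^ (1 / (gamma - H + 1 / 2)).

Lemma critical_timeK A H gamma : 0 < gamma - H + 1 / 2 -> 0 <= small_root A H ->
  critical_time A H gamma `^ (gamma - H + 1 / 2) = small_root A H.
Proof. by move=> e0 x0; rewrite -powRrM mul1r mulVf ?gt_eqF// powRr1. Qed.

Lemma quadratic_roots A H (x : R) : 2 * H <= A ^+ 2 ->
  x ^+ 2 - 2 * A * x + 2 * H = (x - small_root A H) * (x - (2 * A - small_root A H)).
Proof.
move=> D0; rewrite /small_root; set r := Num.sqrt _.
have r2 : r ^+ 2 = A ^+ 2 - 2 * H by rewrite sqr_sqrtr// subr_ge0.
by rewrite -[2 * H](subKr (A ^+ 2)) -r2; ring.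
Qed.

(** The product of the two roots is [2 * H] and the larger one lies between [A]
    and [2 * A]. *)
Lemma small_root_bounds A H : 0 < H -> 0 < A -> 2 * H <= A ^+ 2 ->
  [/\ H <= A * small_root A H, A * small_root A H <= 2 * H & small_root A H <= A].
Proof.
move=> H0 A0 D0; rewrite /small_root; set r := Num.sqrt _.
have r0 : 0 <= r by exact: sqrtr_ge0.
have r2 : r ^+ 2 = A ^+ 2 - 2 * H by rewrite sqr_sqrtr// subr_ge0.
by split; nra.
Qed.

Lemma profile_max_at1 A H gamma : 0 < H -> H < 1 / 2 -> 0 < gamma ->
  0 <= profile A H gamma 1 ->
  (forall x, 0 < x < 1 -> 0 <= x ^+ 2 - 2 * A * x + 2 * H) ->
  forall t, 0 <= t <= 1 -> profile A H gamma t <= profile A H gamma 1.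
Proof.
move=> H0 H12 g0 f1 quad t /andP[]; rewrite le_eqVlt => /predU1P[<-|t0] t1.
  by rewrite profile0.
apply: profile_nondecreasing => // u /andP[tu u1]; apply: quad.
have u0 : 0 < u by exact: lt_trans tu.
rewrite powR_gt0//=.
have := @gt0_ltr_powR R (gamma - H + 1 / 2) ltac:(lra) u 1.
by rewrite powR1 !nnegrE; apply => //; exact: ltW.
Qed.

(** The profile increases up to the critical time, then decreases until [x]
    reaches the larger root (if it does so before time [1]), then increases. *)
Lemma profile_two_candidates A H gamma : 0 < H -> H < 1 / 2 -> 0 < gamma ->
  0 <= profile A H gamma 1 -> 0 < A -> 2 * H <= A ^+ 2 -> small_root A H <= 1 ->
  forall t, 0 <= t <= 1 ->
    profile A H gamma t <= profile A H gamma (critical_time A H gamma) \/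
    profile A H gamma t <= profile A H gamma 1.
Proof.
move=> H0 H12 g0 f1 A0 D0 x1 t /andP[]; rewrite le_eqVlt => /predU1P[<-|t0] t1.
  by right; rewrite profile0.
have [Hx xH xA] := small_root_bounds H0 A0 D0.
have sr0 : 0 < small_root A H by nra.
have e0 : 0 < gamma - H + 1 / 2 by lra.
set tc := critical_time A H gamma.
have tcE : tc `^ (gamma - H + 1 / 2) = small_root A H.
  by rewrite critical_timeK// ltW.
have tc0 : 0 < tc by rewrite powR_gt0.
have mono (u v : R) : 0 < u -> 0 < v -> u <= v ->
    u `^ (gamma - H + 1 / 2) <= v `^ (gamma - H + 1 / 2).
  by move=> u0 v0 uv; rewrite ge0_ler_powR ?nnegrE// ltW.
have [ttc|/ltW tct] := leP t tc.
  left; apply: profile_nondecreasing => // u /andP[tu utc].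
  rewrite quadratic_roots//; have := mono u tc (lt_trans t0 tu) tc0 (ltW utc).
  rewrite tcE; set x := u `^ _ => xx; nra.
have [xt|xt] := leP (t `^ (gamma - H + 1 / 2)) (2 * A - small_root A H).
  left; apply: profile_nonincreasing => // u /andP[tcu ut].
  have u0 := lt_trans tc0 tcu.
  rewrite quadratic_roots//.
  have := mono _ _ tc0 u0 (ltW tcu); have := mono _ _ u0 t0 (ltW ut).
  rewrite tcE; set x := u `^ _; nra.
right; apply: profile_nondecreasing => // u /andP[tu u1].
have u0 := lt_trans t0 tu.
rewrite quadratic_roots//; have := mono _ _ t0 u0 (ltW tu).
set x := u `^ _; nra.
Qed.

Lemma critical_time01 A H gamma : 0 < H -> 0 < gamma - H + 1 / 2 -> 0 < A ->
  2 * H <= A ^+ 2 -> small_root A H <= 1 -> 0 <= critical_time A H gamma <= 1.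
Proof.
move=> H0 e0 A0 D0 x1; have [Hx _ _] := small_root_bounds H0 A0 D0.
rewrite powR_ge0 /=.
have sr0 : 0 <= small_root A H by nra.
have ie0 : 0 <= 1 / (gamma - H + 1 / 2) by rewrite divr_ge0// ltW.
have := ge0_ler_powR ie0 (x := small_root A H) (y := 1).
by rewrite powR1 !nnegrE; apply.
Qed.

(** If the quadratic polynomial has no real root, or no root in [`]0, 1[], the
    profile is nondecreasing on [[0, 1]]. Otherwise its maximum is attained at
    the critical time or at [1]. *)
Lemma profile_dichotomy A H gamma : 0 < H -> H < 1 / 2 -> 0 < gamma ->
  0 <= profile A H gamma 1 ->
  (forall t, 0 <= t <= 1 -> profile A H gamma t <= profile A H gamma 1) \/
  (0 <= critical_time A H gamma <= 1 /\ forall t, 0 <= t <= 1 ->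
    profile A H gamma t <= profile A H gamma (critical_time A H gamma)).
Proof.
move=> H0 H12 g0 f1.
have [D0|D0] := leP (A ^+ 2) (2 * H).
  by left; apply: profile_max_at1 => // x _; have := sqr_ge0 (x - A); nra.
have [A0|A0] := leP A 0.
  by left; apply: profile_max_at1 => // x /andP[x0 _]; nra.
have [Hx xH xA] := small_root_bounds H0 A0 (ltW D0).
have [x1|x1] := leP 1 (small_root A H).
  left; apply: profile_max_at1 => // x /andP[x0 xlt1].
  by rewrite quadratic_roots ?ltW//; nra.
have cand := profile_two_candidates H0 H12 g0 f1 A0 (ltW D0) (ltW x1).
have [f1c|fc1] := leP (profile A H gamma 1)
    (profile A H gamma (critical_time A H gamma)); [right|left].
  split; last by move=> t /cand[//|/le_trans]; exact.
  by apply: critical_time01 => //; [lra|exact: ltW|exact: ltW].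
by move=> t /cand[/le_trans|//]; apply; exact: ltW.
Qed.

Lemma ln_le_quarter (y : R) : 0 < y -> ln y <= y / 4 + 2.
Proof.
move=> y0.
have y4 : 0 < y / 4 by rewrite divr_gt0.
have -> : y = (y / 4) * 4 by field.
rewrite lnM ?posrE// mulfK//.
have := @le_ln1Dx R (y / 4 - 1) ltac:(lra).
have := @le_ln1Dx R 3 ltac:(lra).
have -> : 1 + (y / 4 - 1) = y / 4 by ring.
have -> : 1 + 3 = 4 :> R by ring.
lra.
Qed.

(** Write [x] for the smaller root, [G = gamma + 1 / 2 + H] and
    [e = gamma - H + 1 / 2]. The profile falls short of [1] by about [2 * A / G]
    at time [1]. At the critical time, which is [x `^ (1 / e)] with
    [H / A <= x <= 2 * H / A], the shortfall is at most
    [2 * H * ln (A / H) / e + 4 * H / G]. A logarithm is dominated by a linear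
    function, and [G <= 2 * e], so the critical time wins once [A] exceeds an
    absolute constant. *)
Lemma critical_time_beats1 A H gamma : 0 < H -> H < 1 / 2 -> 1 <= gamma ->
  7 <= A -> small_root A H <= 1 /\
  profile A H gamma 1 <= profile A H gamma (critical_time A H gamma).
Proof.
move=> H0 H12 g1 A7.
have D0 : 2 * H <= A ^+ 2 by nra.
have A0 : 0 < A by lra.
have [Hx xH xA] := small_root_bounds H0 A0 D0.
set x := small_root A H in Hx xH xA *.
have x0 : 0 < x by nra.
split; first by nra.
set e := gamma - H + 1 / 2; have e0 : 0 < e by rewrite /e; lra.
set G := gamma + 1 / 2 + H; have G0 : 0 < G by rewrite /G; lra.
have eG : e^-1 <= 2 * G^-1.
  rewrite ler_pdivlMr// mulrC ler_pdivrMr// /G /e; lra.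
have gG : 1 / (2 * gamma + 1) <= G^-1.
  by rewrite div1r lef_pV2 ?posrE// /G; lra.
have tc0 : 0 < critical_time A H gamma by rewrite powR_gt0.
rewrite profile1 profile_factor// critical_timeK ?(ltW x0)// -/x -/G.
set T := critical_time A H gamma `^ (2 * H).
have T0 : 0 <= T by exact: powR_ge0.
have Tlb : 1 - (A / 2 + 4 * H) * e^-1 <= T.
  rewrite /T -powRrM /powR gt_eqF//.
  apply: le_trans (expR_ge1Dx _).
  have lnx : - (A / H / 4 + 2) <= ln x.
    have xA' : (A / H)^-1 <= x by rewrite invf_div ler_pdivrMr// mulrC.
    have AH0 : 0 < A / H by rewrite divr_gt0.
    have := ln_le_quarter AH0; rewrite -lerN2 => /le_trans; apply.
    by rewrite -lnV ?posrE// ler_ln ?posrE ?invr_gt0.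
  have k0 : 0 <= 1 / e * (2 * H) by rewrite mulr_ge0 ?divr_ge0//; lra.
  rewrite lerD2l; apply: le_trans (ler_wpM2l k0 lnx).
  rewrite le_eqVlt; apply/orP; left; apply/eqP; field.
  by rewrite !gt_eqF.
set v := 2 * (A / G) * x.
have v0 : 0 <= v by rewrite !mulr_ge0 ?invr_ge0// ltW.
have vlb : v <= 4 * H * G^-1.
  have -> : v = 2 * (A * x) * G^-1 by rewrite /v; ring.
  rewrite ler_pM2r ?invr_gt0//; lra.
have v1 : v <= 1.
  by apply: (le_trans vlb); rewrite ler_pdivrMr// /G; lra.
have Gi0 : 0 < G^-1 by rewrite invr_gt0.
have step : T * (1 - v) <= T * (1 - v + x ^+ 2 / (2 * gamma + 1)).
  by rewrite ler_wpM2l// lerDl divr_ge0 ?sqr_ge0//; lra.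
apply: le_trans step.
have L0 : 0 <= (A / 2 + 4 * H) * e^-1 by rewrite mulr_ge0 ?invr_ge0 ?ltW//; lra.
have LG : (A / 2 + 4 * H) * e^-1 <= (A / 2 + 4 * H) * (2 * G^-1).
  by rewrite ler_wpM2l//; lra.
have : (1 - (A / 2 + 4 * H) * e^-1) * (1 - v) <= T * (1 - v).
  by rewrite ler_wpM2r// subr_ge0.
apply: le_trans.
set L := (A / 2 + 4 * H) * e^-1 in L0 LG *.
have : 1 - L - v <= (1 - L) * (1 - v) by nra.
apply: le_trans.
set i := G^-1 in gG vlb Gi0 LG *.
have : (A - 12 * H - 1) * i >= 0 by rewrite mulr_ge0 ?ltW//; lra.
lra.
Qed.

End profile.

(** * A lower bound for the beta function *)

Section beta_lower_bound.
Context {R : realType}.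
Local Notation mu := (@lebesgue_measure R).

Lemma powR_bernoulli (p x : R) : 0 <= p -> 1 / 2 <= x -> x <= 1 ->
  1 - 2 * p * (1 - x) <= x `^ p.
Proof.
move=> p0 xh x1; have x0 : 0 < x by lra.
rewrite /powR gt_eqF//; apply: le_trans (expR_ge1Dx _).
rewrite lerD2l.
have xV0 : 0 < x^-1 by rewrite invr_gt0.
have := @le_ln1Dx R (x^-1 - 1) ltac:(lra).
rewrite addrC subrK lnV ?posrE// => lnx.
have xV2 : x^-1 <= 2 by rewrite invf_ple ?posrE//; lra.
have xVx : x^-1 * x = 1 by rewrite mulVf ?gt_eqF.
have {}lnx : - (2 * (1 - x)) <= ln x by nra.
by have := ler_wpM2l p0 lnx; apply: le_trans; rewrite mulrN mulrCA mulrA.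
Qed.

(** On the interval of length [e = (4 * (a - 1))^-1] to the left of [1], the
    factor [x `^ (a - 1)] is at least [1 / 2] and [(1 - x) `^ (b - 1)] at least
    [e `^ (b - 1)]. *)
Lemma Beta_lower_bound (a b : R) : 2 <= a -> 0 < b -> b <= 1 ->
  (4 * (a - 1))^-1 `^ b / 2 <= Beta a b.
Proof.
move=> a2 b0 b1; set e := (4 * (a - 1))^-1.
have e0 : 0 < e by rewrite invr_gt0; lra.
have e14 : e <= 1 / 4.
  by rewrite div1r lef_pV2 ?posrE//; lra.
have ea : (a - 1) * e = 1 / 4 by rewrite /e; field; rewrite gt_eqF//; lra.
rewrite -lee_fin -BetaE//; last lra.
have f0 (x : R) : (0 <= (x `^ (a - 1) * (1 - x) `^ (b - 1))%:E)%E.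
  by rewrite lee_fin mulr_ge0 ?powR_ge0.
apply: (@le_trans _ _ (\int[mu]_(x in `](1 - e)%R, 1%R[)
    (x `^ (a - 1) * (1 - x) `^ (b - 1))%:E)%E); last first.
  apply: ge0_subset_integral => //.
  - exact: measurable_beta_integrand.
  - by apply: subset_itvr; rewrite bnd_simp; lra.
apply: (@le_trans _ _ (\int[mu]_(x in `](1 - e)%R, 1%R[) (cst (e `^ (b - 1) / 2)%:E x))%E).
  rewrite integral_cst//= lebesgue_measure_itv /= lte_fin gtrBl e0.
  rewrite -EFinB -EFinM lee_fin.
  have {1}-> : b = b - 1 + 1 by ring.
  rewrite powRD ?(gt_eqF e0) ?implybT// powRr1 ?(ltW e0)//.
  by rewrite le_eqVlt; apply/orP; left; apply/eqP; field.
apply: ge0_le_integral => //.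
- by move=> x _; rewrite lee_fin divr_ge0 ?powR_ge0.
- exact: measurable_beta_integrand.
move=> x /=; rewrite in_itv /= => /andP[xe x1]; rewrite lee_fin.
have B : 1 / 2 <= x `^ (a - 1).
  have := @powR_bernoulli (a - 1) x ltac:(lra) ltac:(lra) (ltW x1).
  by apply: le_trans; nra.
have C : e `^ (b - 1) <= (1 - x) `^ (b - 1).
  have x10 : 0 < 1 - x by rewrite subr_gt0.
  have -> : b - 1 = - (1 - b) by ring.
  rewrite !powRN lef_pV2 ?posrE ?powR_gt0//.
  by apply: ge0_ler_powR; rewrite ?nnegrE; lra.
have := powR_ge0 e (b - 1); nra.
Qed.

End beta_lower_bound.

(** * The mean square distance *)

Section mean_square_distance.
Context {R : realType} {d : measure_display} {T : measurableType d}
  (P : probability T R) (W B M : R -> {RV P >-> R}).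
Local Notation mu := (@lebesgue_measure R).

Lemma molchan_kernel_ge0 (H t s : R) : H < 1 / 2 -> 0 <= molchan_kernel H t s.
Proof.
move=> H12; rewrite mulr_ge0 ?sqrtr_ge0// addr_ge0 ?mulr_ge0 ?powR_ge0//.
rewrite oppr_ge0 -mulrA mulr_le0_ge0//; first lra.
by rewrite mulr_ge0 ?powR_ge0//; apply: Rintegral_ge0 => u _; rewrite mulr_ge0 ?powR_ge0.
Qed.

Lemma ge0_integral_restrict01 (t : R) (f : R -> \bar R) : 0 <= t -> t <= 1 ->
  (\int[mu]_(s in `[0%R, 1%R]) ((f \_ `]0%R, t[) s) = \int[mu]_(s in `]0%R, t[) f s)%E.
Proof.
move=> t0 t1; rewrite -integral_mkcondr; congr (integral _ _ _).
apply/setIidr => s /=; rewrite !in_itv /= => /andP[s0 st].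
by apply/andP; split; lra.
Qed.

(** Moving the cross term to the other side leaves only nonnegative integrals,
    which add up before they are known to be finite. *)
Lemma sqr_diff_integral_decomposition (D : set (measurableTypeR R)) (f g : R -> R)
    (a b k : R) :
  measurable D -> measurable_fun D f -> measurable_fun D g ->
  (forall s, 0 <= f s * g s) ->
  (\int[mu]_(s in D) (f s ^+ 2)%:E = a%:E)%E ->
  (\int[mu]_(s in D) (g s ^+ 2)%:E = b%:E)%E ->
  (\int[mu]_(s in D) (f s * g s)%:E = k%:E)%E ->
  (\int[mu]_(s in D) ((f s - g s) ^+ 2)%:E = (a - 2 * k + b)%:E)%E.
Proof.
move=> mD mf mg fg0 fa gb fgk.
have msq (h : R -> R) : measurable_fun D h -> measurable_fun D (fun s => (h s ^+ 2)%:E).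
  by move=> mh; exact/measurable_EFinP/measurable_funX.
have sq0 (h : R -> R) s : D s -> (0 <= (h s ^+ 2)%:E)%E by rewrite lee_fin sqr_ge0.
have mfg : measurable_fun D (fun s => (f s * g s)%:E).
  exact/measurable_EFinP/measurable_funM.
have mfBg : measurable_fun D (fun s => f s - g s) by exact: measurable_funB.
have E : (\int[mu]_(s in D) (f s ^+ 2)%:E + \int[mu]_(s in D) (g s ^+ 2)%:E =
    \int[mu]_(s in D) ((f s - g s) ^+ 2)%:E +
    2%:E * \int[mu]_(s in D) (f s * g s)%:E)%E.
  rewrite -ge0_integralZl_EFin//; last by move=> s _; rewrite lee_fin.
  rewrite -ge0_integralD//; [|exact: sq0|exact: msq|exact: sq0|exact: msq].
  rewrite -ge0_integralD//; last 4 first.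
  - exact: (sq0 (fun s => f s - g s)).
  - exact: (msq (fun s => f s - g s)).
  - by move=> s _; rewrite -EFinM lee_fin mulr_ge0.
  - exact: measurable_funeM.
  by apply: eq_integral => s _; rewrite -EFinM -!EFinD; congr EFin; ring.
move: E; rewrite fa gb fgk -EFinD -EFinM => E.
have fin : (\int[mu]_(s in D) ((f s - g s) ^+ 2)%:E)%E \is a fin_num.
  have : (a + b)%:E \is a fin_num by [].
  by rewrite E fin_numD => /andP[].
move: E; rewrite -(fineK fin) -EFinD => -[E]; congr EFin; lra.
Qed.

(** By the isometry the distance is the squared norm of the difference of the
    integrands. The squared norm of the kernel is known without computation:
    it is the variance [t `^ (2 * H)] of the fractional Brownian motion. *)
Lemma mean_square_distanceE (H gamma t : R) :
  0 < H -> H < 1 / 2 -> 0 < gamma -> 0 <= t -> t <= 1 ->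
  molchan_fbm H W B -> power_integral gamma W M ->
  mean_square_distance B M t =
  (profile (molchan_const H * Beta (gamma - H + 3 / 2) (H + 1 / 2) * (gamma + 1))
     H gamma t)%:E.
Proof.
move=> H0 H12 g0 t0 t1 [WW [_ _ covB] BW] MW.
have t01 : t \in `[0, 1] by rewrite in_itv /= t0 t1.
have iB := BW t t01; have iM := MW t t01.
rewrite /mean_square_distance unlock (wiener_isometryB WW iB iM).
have [mz _ _] := iB; have [mp _ _] := iM.
rewrite (@sqr_diff_integral_decomposition _ _ _ (t `^ (2 * H))
  (t `^ (2 * gamma + 1) / (2 * gamma + 1))
  (molchan_const H * Beta (gamma - H + 3 / 2) (H + 1 / 2) *
    ((gamma + 1) / (gamma + 1 / 2 + H)) * t `^ (gamma + 1 / 2 + H)))//.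
- by congr EFin; rewrite /profile; ring.
- move=> s; rewrite !patchE; case: ifPn => _; last by rewrite mulr0.
  by rewrite mulr_ge0 ?molchan_kernel_ge0 ?powR_ge0.
- rewrite -(wiener_isometry WW iB).
  have := covB t t t01 t01; rewrite unlock subrr normr0 powR0; last first.
    by rewrite mulf_neq0 ?gt_eqF.
  rewrite subr0 => E; transitivity (\int[P]_w (B t w * B t w)%:E)%E; first by [].
  by rewrite E; congr EFin; field.
- transitivity (\int[mu]_(s in `[0%R, 1%R])
      ((fun s => (s `^ (2 * gamma))%:E) \_ `]0%R, t[) s)%E.
    apply: eq_integral => s _; rewrite !patchE; case: ifPn => [|_]; last by rewrite expr0n.
    rewrite mem_setE in_itv /= => /andP[s0 _].
    by rewrite mulrC powRrM powR_mulrn ?powR_ge0.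
  rewrite ge0_integral_restrict01//.
  move: t0; rewrite le_eqVlt => /predU1P[<-|t0].
    by rewrite set_itv_ge ?bnd_simp ?ltxx// integral_set0 powR0 ?mul0r// gt_eqF//; lra.
  by rewrite integral_powR//; lra.
- transitivity (\int[mu]_(s in `[0%R, 1%R])
      ((fun s => (molchan_kernel H t s * s `^ gamma)%:E) \_ `]0%R, t[) s)%E.
    by apply: eq_integral => s _; rewrite !patchE; case: ifPn => // _; rewrite mul0r.
  rewrite ge0_integral_restrict01//.
  move: t0; rewrite le_eqVlt => /predU1P[<-|t0].
    by rewrite set_itv_ge ?bnd_simp ?ltxx// integral_set0 powR0 ?mulr0// gt_eqF//; lra.
  by rewrite integral_molchan_power.
Qed.

(** If the constant vanished, so would the kernel, and then the isometry would
    give [B 1] variance [0] instead of [1]. *)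
Lemma molchan_const_gt0 (H : R) : 0 < H -> molchan_fbm H W B -> 0 < molchan_const H.
Proof.
move=> H0 [WW [_ _ covB] BW].
rewrite lt_neqAle sqrtr_ge0 andbT; apply/eqP => c0.
have in01 : 1 \in `[(0 : R), 1] by rewrite in_itv /= ler01 lexx.
have := covB 1 1 in01 in01; rewrite unlock subrr normr0 powR0; last first.
  by rewrite mulf_neq0 ?gt_eqF.
rewrite powR1 => EB.
have := wiener_isometry WW (BW 1 in01).
have -> : (\int[P]_w (B 1 w ^+ 2)%:E = 1)%E.
  transitivity (\int[P]_w (B 1 w * B 1 w)%:E)%E; first by [].
  by rewrite EB; congr EFin; field.
rewrite integral0_eq => [/eqP|s _]; first by rewrite eqe oner_eq0.
by rewrite patchE /molchan_kernel -c0 mul0r; case: ifP => _; rewrite expr0n.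
Qed.

End mean_square_distance.

(** * Large exponents *)

Section large_gamma.
Context {R : realType}.

(** By the lower bound on the beta function the coefficient is at least
    [c / 8 * (4 * (gamma + 1)) `^ (1 / 2 - H)], which tends to infinity with
    [gamma] because [H < 1 / 2]. *)
Lemma critical_coefficient_large (c H gamma : R) :
  0 < c -> 0 < H -> H < 1 / 2 -> 1 + (56 / c) `^ (1 / (1 / 2 - H)) < gamma ->
  7 <= c * Beta (gamma - H + 3 / 2) (H + 1 / 2) * (gamma + 1).
Proof.
move=> c0 H0 H12 gbig.
have K0 := powR_ge0 (56 / c) (1 / (1 / 2 - H)).
set y := 4 * (gamma + 1).
have y0 : 0 < y by rewrite /y; lra.
have yb : 56 / c <= y `^ (1 / 2 - H).
  have c56 : 0 < 56 / c by rewrite divr_gt0.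
  have -> : 56 / c = ((56 / c) `^ (1 / (1 / 2 - H))) `^ (1 / 2 - H).
    by rewrite -powRrM mul1r mulVf ?gt_eqF ?subr_gt0// powRr1 ?ltW.
  by apply: ge0_ler_powR; rewrite ?nnegrE /y; lra.
have Bl : y^-1 `^ (H + 1 / 2) / 2 <= Beta (gamma - H + 3 / 2) (H + 1 / 2).
  have := @Beta_lower_bound R (gamma - H + 3 / 2) (H + 1 / 2)
    ltac:(lra) ltac:(lra) ltac:(lra).
  apply: le_trans; rewrite ler_pM2r//.
  apply: ge0_ler_powR; rewrite ?nnegrE ?invr_ge0; [lra|lra|lra|].
  by rewrite lef_pV2 ?posrE /y; lra.
have : c * (y^-1 `^ (H + 1 / 2) / 2) * (gamma + 1) <=
    c * Beta (gamma - H + 3 / 2) (H + 1 / 2) * (gamma + 1).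
  rewrite ler_wpM2r//; first lra.
  by rewrite ler_wpM2l// ltW.
apply: le_trans.
have -> : c * (y^-1 `^ (H + 1 / 2) / 2) * (gamma + 1) = c / 8 * y `^ (1 / 2 - H).
  have -> : gamma + 1 = y / 4 by rewrite /y; field.
  have -> : y `^ (1 / 2 - H) = y * y^-1 `^ (H + 1 / 2).
    rewrite -(powR_inv1 (ltW y0)) -powRrM mulN1r -{2}(powRr1 (ltW y0)) -powRD.
      by congr (_ `^ _); field.
    by rewrite (gt_eqF y0) implybT.
  by field.
have := yb; rewrite ler_pdivrMr// => h; lra.
Qed.

End large_gamma.

(** * The theorem *)

Theorem theorem1 (R : realType) (H : R) (H_gt0 : 0 < H) (H_lt12 : H < 1 / 2) :
  (forall (d : measure_display) (T : measurableType d) (P : probability T R)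
      (W B : R -> {RV P >-> R}), molchan_fbm H W B ->
    forall (gamma : R) (M : R -> {RV P >-> R}),
      0 < gamma -> power_integral gamma W M ->
      max_reached_at `[0, 1] (mean_square_distance B M) 1 \/
      max_reached_at `[0, 1] (mean_square_distance B M) (t1 gamma H))
  /\
  (exists gamma0 : R, 0 < gamma0 /\
    forall (d : measure_display) (T : measurableType d) (P : probability T R)
      (W B : R -> {RV P >-> R}), molchan_fbm H W B ->
    forall (gamma : R) (M : R -> {RV P >-> R}),
      gamma0 < gamma -> power_integral gamma W M ->
      max_reached_at `[0, 1] (mean_square_distance B M) (t1 gamma H) /\
      mean_square_distance B M (t1 gamma H) =
        (t1 gamma H `^ (2 * H)
         - 2 * t1 gamma H `^ (gamma + 1 / 2 + H) * molchan_const H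
             * Beta (gamma - H + 3 / 2) (H + 1 / 2)
             * ((gamma + 1) / (gamma + 1 / 2 + H))
         + 1 / (2 * gamma + 1) * t1 gamma H `^ (2 * gamma + 1))%:E).
Proof.
pose A gamma := molchan_const H * Beta (gamma - H + 3 / 2) (H + 1 / 2) * (gamma + 1).
have t1E gamma : t1 gamma H = critical_time (A gamma) H gamma.
  by rewrite /t1 /critical_time /small_root /A; congr ((_ - Num.sqrt _) `^ _); ring.
have msdE d (T : measurableType d) (P : probability T R) (W B : R -> {RV P >-> R})
    (gamma : R) (M : R -> {RV P >-> R}) : molchan_fbm H W B -> 0 < gamma ->
    power_integral gamma W M -> forall t : R, 0 <= t <= 1 ->
    mean_square_distance B M t = (profile (A gamma) H gamma t)%:E.
  by move=> HB g0 HM t /andP[t0 t1]; exact: (mean_square_distanceE H_gt0 H_lt12 g0 t0 t1 HB HM).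
have in01 (t : R) : `[0, 1]%classic t = (0 <= t <= 1) :> Prop by rewrite /= in_itv.
have le01 : 0 <= (1 : R) <= 1 by rewrite ler01 lexx.
have profile1_ge0 d (T : measurableType d) (P : probability T R) (W B : R -> {RV P >-> R})
    (gamma : R) (M : R -> {RV P >-> R}) : molchan_fbm H W B -> 0 < gamma ->
    power_integral gamma W M -> 0 <= profile (A gamma) H gamma 1.
  move=> HB g0 HM; rewrite -lee_fin -(msdE _ _ _ _ _ _ _ HB g0 HM 1 le01).
  by rewrite /mean_square_distance unlock; apply: integral_ge0 => w _; rewrite lee_fin sqr_ge0.
split.
  move=> d T P W B HB gamma M g0 HM.
  have msd := msdE _ _ _ _ _ _ _ HB g0 HM.
  have f1 := profile1_ge0 _ _ _ _ _ _ _ HB g0 HM.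
  have [max1|[tc01 maxtc]] := profile_dichotomy H_gt0 H_lt12 g0 f1; [left|right].
    split; first by rewrite in01.
    by move=> t; rewrite in01 => t01; rewrite !msd// lee_fin max1.
  rewrite t1E; split; first by rewrite in01.
  by move=> t; rewrite in01 => t01; rewrite !msd// lee_fin maxtc.
exists (1 + (56 / molchan_const H) `^ (1 / (1 / 2 - H))).
split; first by rewrite ltr_pwDl// powR_ge0.
move=> d T P W B HB gamma M gbig HM.
have g1 : 1 <= gamma by apply: ltW; apply: le_lt_trans gbig; rewrite lerDl powR_ge0.
have g0 : 0 < gamma by exact: lt_le_trans g1.
have msd := msdE _ _ _ _ _ _ _ HB g0 HM.
have f1 := profile1_ge0 _ _ _ _ _ _ _ HB g0 HM.
have A7 : 7 <= A gamma.
  exact: critical_coefficient_large (molchan_const_gt0 H_gt0 HB) H_gt0 H_lt12 gbig.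
have [x1 f1c] := critical_time_beats1 H_gt0 H_lt12 g1 A7.
have A0 : 0 < A gamma by lra.
have D0 : 2 * H <= A gamma ^+ 2 by nra.
have cand := profile_two_candidates H_gt0 H_lt12 g0 f1 A0 D0 x1.
have tc01 : 0 <= critical_time (A gamma) H gamma <= 1 by apply: critical_time01 => //; lra.
rewrite t1E; split; last first.
  by rewrite msd// /profile /A; congr EFin; ring.
split; first by rewrite in01.
move=> t; rewrite in01 => t01; rewrite !msd// lee_fin.
by have [//|/le_trans] := cand t t01; apply.
Qed.
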